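(* Let $0\le k\le n-1$ and let $\Sigma^n$ be a connected orientable self-shrinker of the $Q_k$-flow properly immersed in $\mathbb{R}^{n+1}$. Suppose that $\sigma_k$ is bounded and that $P_k$ is coercive. If \[ |x^\perp|^2\geq 2(n-k)\quad\text{on }\Sigma, \] then $\Sigma=\mathbb{S}^n\bigl(\sqrt{2(n-k)}\bigr)$.
   Context: Hypersurfaces are smooth, without boundary, with induced metric, immersion $x:\Sigma^n\to\mathbb{R}^{n+1}$ (also the position vector) and chosen unit normal field $\nu$; $x^\perp$ is the normal component of $x$. The equality $\Sigma=\mathbb{S}^n(\rho)$ means that the image $x(\Sigma)$ is the sphere of radius $\rho$ centered at the origin. With $\overline{\nabla}$ the flat connection of $\mathbb{R}^{n+1}$, the shape operator is $A(X)=\overline{\nabla}_X\nu$, with eigenvalues (principal curvatures) $\lambda_1,\dots,\lambda_n$. For $1\le k\le n$, $\sigma_k=\sum_{i_1<\cdots<i_k}\lambda_{i_1}\cdots\lambda_{i_k}$, with $\sigma_0=1$ and $\sigma_j=0$ for $j>n$. The Newton transformations are $P_0=I$, $P_k=\sigma_k I-AP_{k-1}$. A symmetric endomorphism $P$ of $T\Sigma$ is coercive if there is a constant $\delta>0$ with $\langle P(X),X\rangle\ge\delta|X|^2$ for all $X\in T\Sigma$. A hypersurface with $\sigma_k\ne0$ everywhere is a self-shrinker of the $Q_k$-flow if \[ \frac{\sigma_{k+1}}{\sigma_k}=\frac{1}{2(k+1)}\langle x,\nu\rangle . \] *)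

(* Defs.v *)
From HB Require Import structures.
From mathcomp Require Export all_boot all_order all_algebra.
From mathcomp Require Export all_classical all_reals all_analysis.
Export Order.TTheory GRing.Theory Num.Theory.
Export numFieldNormedType.Exports.

Set Implicit Arguments.
Unset Strict Implicit.
Unset Printing Implicit Defensive.

Local Open Scope classical_set_scope.
Local Open Scope ring_scope.

Definition dot (R : realType) (m : nat) (u v : 'rV[R]_m) : R :=
  \sum_(i < m) u 0 i * v 0 i.

(* The library's norm on row vectors is the sup norm; this is the Euclidean
   one. Both induce the same topology. *)
Definition enorm (R : realType) (m : nat) (u : 'rV[R]_m) : R :=
  Num.sqrt (dot u u).

Definition origin_sphere (R : realType) (m : nat) (rho : R) : set 'rV[R]_m :=
  [set y | enorm y = rho].

(* Class C^r on an open set U: f is C^(r+1) iff it is Frechet differentiable on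
   U and its partial derivatives are C^r on U. *)
Fixpoint Cr (R : realType) (n m r : nat) (U : set 'rV[R]_n)
    (f : 'rV[R]_n -> 'rV[R]_m) : Prop :=
  match r with
  | 0 => forall u, U u -> {for u, continuous f}
  | r'.+1 => (forall u, U u -> differentiable f u) /\
      forall i : 'I_n, Cr r' U (fun u => 'D_(delta_mx 0 i) f u)
  end.

Definition smooth_on (R : realType) (n m : nat) (U : set 'rV[R]_n)
    (f : 'rV[R]_n -> 'rV[R]_m) : Prop :=
  forall r, Cr r U f.

Section Manifold.
Variables (R : realType) (S : topologicalType) (n : nat).

(* The values of [coord] outside [chart_dom] and of [param] outside
   [chart_codom] are irrelevant. *)
Record chart := Chart {
  chart_dom : set S;
  coord : S -> 'rV[R]_n;
  param : 'rV[R]_n -> S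
}.

Definition chart_codom (c : chart) : set 'rV[R]_n := coord c @` chart_dom c.

(* [coord c] is a homeomorphism from the open set [chart_dom c] onto the open set
   [chart_codom c] of R^n, with inverse [param c]. *)
Definition is_chart (c : chart) : Prop :=
  [/\ open (chart_dom c), open (chart_codom c),
      forall p, chart_dom c p -> param c (coord c p) = p,
      forall p, chart_dom c p -> {for p, continuous (coord c)} &
      forall u, chart_codom c u -> {for u, continuous (param c)}].

Definition overlap (c c' : chart) : set 'rV[R]_n :=
  coord c @` (chart_dom c `&` chart_dom c').

Definition transition (c c' : chart) : 'rV[R]_n -> 'rV[R]_n :=
  coord c' \o param c.

Definition smooth_atlas (A : set chart) : Prop :=
  [/\ forall c, A c -> is_chart c,
      forall p, exists2 c, A c & chart_dom c p &
      forall c c', A c -> A c' -> smooth_on (overlap c c') (transition c c')].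

Definition smooth_manifold (A : set chart) : Prop :=
  [/\ hausdorff_space S, @second_countable S & smooth_atlas A].

(* Some atlas defining the same smooth structure as A has transition maps of
   positive Jacobian determinant. *)
Definition orientable (A : set chart) : Prop :=
  exists B : set chart,
    [/\ smooth_atlas B, smooth_atlas (A `|` B) &
        forall c c' u, B c -> B c' -> overlap c c' u ->
          0 < \det ('J (transition c c') u)].

Variable m : nat.

Definition smooth_map (A : set chart) (f : S -> 'rV[R]_m) : Prop :=
  forall c, A c -> smooth_on (chart_codom c) (f \o param c).

(* Row i is the derivative of f along the i-th coordinate vector field of c,
   so v *m jac c f p is df_p applied to the tangent vector of coordinates v. *)
Definition jac (c : chart) (f : S -> 'rV[R]_m) (p : S) : 'M[R]_(n, m) :=
  'J (f \o param c) (coord c p).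

Definition immersion (A : set chart) (f : S -> 'rV[R]_m) : Prop :=
  smooth_map A f /\ forall c p, A c -> chart_dom c p -> row_free (jac c f p).

Definition proper_map (f : S -> 'rV[R]_m) : Prop :=
  forall K, compact K -> compact (f @^-1` K).

End Manifold.

Section Curvature.
Variables (R : realType) (n : nat).

(* The eigenvalues of L with multiplicity, in some order; they exist for the
   shape operator, which is symmetric for the induced metric. If L did not have
   n real eigenvalues, the value would be 0. *)
Definition eigenvalues (L : 'M[R]_n) : 'rV[R]_n :=
  xget 0 [set l : 'rV[R]_n | char_poly L = \prod_(i < n) ('X - (l 0 i)%:P)].

Definition elem_sym (k : nat) (l : 'rV[R]_n) : R :=
  \sum_(I : {set 'I_n} | #|I| == k) \prod_(i in I) l 0 i.

Definition sigma (k : nat) (L : 'M[R]_n) : R := elem_sym k (eigenvalues L).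

(* Endomorphisms act on row vectors on the right, so the matrix of the
   composite "L after P" is P *m L. *)
Fixpoint newton (k : nat) (L : 'M[R]_n) : 'M[R]_n :=
  match k with
  | 0 => 1%:M
  | k'.+1 => (sigma k'.+1 L)%:M - newton k' L *m L
  end.

End Curvature.

Section Hypersurface.
Variables (R : realType) (S : topologicalType) (n : nat).
Variables (A : set (chart R S n)) (x nu : S -> 'rV[R]_n.+1).

Definition unit_normal : Prop :=
  [/\ smooth_map A nu,
      forall p, dot (nu p) (nu p) = 1 &
      forall c p, A c -> chart_dom c p ->
        forall v : 'rV[R]_n, dot (v *m jac c x p) (nu p) = 0].

(* Matrix of the shape operator X |-> dnu(X) in the coordinate basis of c.
   When x is an immersion and nu a unit normal field, the rows of jac c nu p
   lie in the tangent space, i.e. the row space of the row-free jac c x p; the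
   matrix below is then the unique M with M *m jac c x p = jac c nu p. *)
Definition shape (c : chart R S n) (p : S) : 'M[R]_n :=
  jac c nu p *m pinvmx (jac c x p).

Definition normal_part (p : S) : 'rV[R]_n.+1 := dot (x p) (nu p) *: nu p.

Definition self_shrinker (k : nat) : Prop :=
  forall c p, A c -> chart_dom c p ->
    sigma k (shape c p) != 0 /\
    sigma k.+1 (shape c p) / sigma k (shape c p) =
      (2 * k.+1%:R)^-1 * dot (x p) (nu p).

Definition sigma_bounded (k : nat) : Prop :=
  exists M : R, forall c p, A c -> chart_dom c p -> `|sigma k (shape c p)| <= M.

(* [P c p] is the matrix of an endomorphism of the tangent space at p in the
   coordinate basis of c; the metric is the one induced by x. *)
Definition coercive (P : chart R S n -> S -> 'M[R]_n) : Prop :=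
  exists2 delta : R, 0 < delta & forall c p, A c -> chart_dom c p ->
    forall v : 'rV[R]_n,
      let X := v *m jac c x p in
      let PX := v *m P c p *m jac c x p in
      delta * dot X X <= dot PX X.

End Hypersurface.

(* Main.v *)
Require Import Defs.
From mathcomp Require Import zify ring lra.

Set Implicit Arguments.
Unset Strict Implicit.
Unset Printing Implicit Defensive.

Local Open Scope classical_set_scope.
Local Open Scope ring_scope.

(** Since x is proper, |x|^2 attains its minimum r^2.  For an ambient function G
    one has tr(P_k Hess G) = tr(P_k D^2 G) - (k+1) sigma_(k+1) <DG, nu>, so that
    G = |x|^2/2 gives sigma_k ((n-k) - <x, nu>^2/2), which is nonpositive by
    hypothesis: |x|^2 is superharmonic for the elliptic operator tr(P_k Hess).
    At a minimum of |x|^2 this trace is nonnegative and x is normal, hence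
    r^2 = 2(n-k).

    The strong minimum principle is proved with the ambient perturbations
    |y|^2/2 - eps exp(alpha <y, a>).  For large alpha such a function has no local
    minimum on Sigma where the tangential part of a is not small.  If q is close to
    a minimum point of |x| and a = x(q), the points of {|x| = r} near it that
    maximize <x, a> are interior, and there a has a nonzero tangential part unless
    a is a multiple of x; since x is a local immersion transverse to the radial
    direction, that happens only at q itself.  So q is a minimum point too,
    {|x| = r} is open, and by connectedness |x| = r on Sigma.  Finally, for a on
    the sphere, a point of the compact Sigma maximizing <x, a> satisfies
    x = a or x = -a, and the latter would make x constant. *)

(** * Newton transformations and the characteristic polynomial *)

Section CharPoly.
Variables (R : comNzRingType) (n : nat).
Implicit Types (L : 'M[R]_n) (A : 'M[{poly R}]_n).

Lemma deriv_prod (I : finType) (F : I -> {poly R}) :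
  (\prod_i F i)^`() = \sum_i \prod_j (if j == i then (F j)^`() else F j).
Proof.
suff H (r : seq I) : uniq r -> (\prod_(i <- r) F i)^`() =
    \sum_(i <- r) \prod_(j <- r) (if j == i then (F j)^`() else F j).
  by rewrite (H _ (index_enum_uniq I)).
elim: r => [_|a r IH]; first by rewrite !big_nil derivC.
rewrite cons_uniq => /andP[ar ur]; rewrite !big_cons derivM IH// eqxx; congr +%R.
  congr *%R; apply: eq_big_seq => j jr; case: eqP => // ja.
  by rewrite -ja jr in ar.
rewrite big_distrr/=; apply: eq_big_seq => i ir; rewrite big_cons.
by case: eqP => // ai; rewrite ai ir in ar.
Qed.

(** Jacobi's formula: the product rule gives one determinant per differentiated row, and expanding
    it along that row leaves the cofactors of [A]. *)
Lemma deriv_det A :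
  (\det A)^`() = \sum_i \sum_j (A i j)^`() * cofactor A i j.
Proof.
pose B i := \matrix_(a, b) (if a == i then (A a b)^`() else A a b).
transitivity (\sum_i \det (B i)).
  rewrite /determinant raddf_sum exchange_big/=; apply: eq_bigr => s _.
  have deriv_sign (b : bool) (p : {poly R}) :
      ((-1) ^+ b * p)^`() = (-1) ^+ b * p^`().
    by case: b; rewrite ?expr0 ?expr1 ?mul1r ?mulN1r ?derivN.
  rewrite -big_distrr/= deriv_sign deriv_prod; congr *%R; apply: eq_bigr => i _; apply: eq_bigr => j _.
  by rewrite mxE.
apply: eq_bigr => i _; rewrite (expand_det_row _ i); apply: eq_bigr => j _.
rewrite mxE eqxx; congr *%R; rewrite /cofactor; congr (_ * \det _).
by apply/matrixP => a b; rewrite !mxE eq_sym (negbTE (neq_lift _ _)).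
Qed.

Lemma deriv_char_poly L : (char_poly L)^`() = \tr (\adj (char_poly_mx L)).
Proof.
rewrite /char_poly deriv_det; apply: eq_bigr => i _.
rewrite (bigD1 i)//= big1 => [|j ji]; rewrite !mxE.
  by rewrite eqxx derivB derivX derivC subr0 mul1r addr0.
by rewrite eq_sym (negbTE ji) derivB !derivC subr0 mul0r.
Qed.

(** The adjugate of ['X - L] read as a polynomial with matrix coefficients; up to sign these
    coefficients are the Newton transformations. *)
Definition adj_coef L (d : nat) : 'M[R]_n :=
  \matrix_(i, j) (\adj (char_poly_mx L) i j)`_d.

(** Compares the coefficients of degree [d] in the identity between the product of the adjugate with
    ['X - L] and the scalar matrix of [char_poly L]. *)
Lemma coef_adj_mul L d :
  (if d is e.+1 then adj_coef L e else 0) - adj_coef L d *m L =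
  ((char_poly L)`_d)%:M.
Proof.
apply/matrixP => i j; rewrite /adj_coef.
have := congr1 (fun M : 'M[{poly R}]_n => (M i j)`_d) (mul_adj_mx (char_poly_mx L)).
move: (\adj _) => M; rewrite -/(char_poly L) [in X in X = _ -> _]mxE [in X in _ = X -> _]mxE coefMn => h.
rewrite [RHS]mxE -h coef_sum {h}.
transitivity (\sum_k ((M i k * 'X)`_d *+ (k == j) - (M i k)`_d * L k j)).
  rewrite sumrB (bigD1 j)//= eqxx big1 => [|k /negbTE->]; last by rewrite mulr0n.
  rewrite addr0 coefMX [LHS]mxE; congr (_ + _).
    by case: d => [|d] /=; rewrite !mxE.
  by rewrite !mxE; congr (- _); apply: eq_bigr => k _; rewrite mxE.
apply: eq_bigr => k _.
have -> : char_poly_mx L k j = 'X *+ (k == j) - (L k j)%:P by rewrite !mxE.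
by rewrite mulrBr coefB mulrnAr coefMn coefMC.
Qed.

Lemma adj_coefS L d :
  adj_coef L d = ((char_poly L)`_d.+1)%:M + adj_coef L d.+1 *m L.
Proof. by rewrite -coef_adj_mul subrK. Qed.

Lemma adj_coef_eq0 L d : (n <= d)%N -> adj_coef L d = 0.
Proof.
(* Every entry of the adjugate has size at most [m]. From degree [d + m], [adj_coefS] descends to
   [d], since [char_poly L] has no coefficient above degree [n]; the right disjunct below covers
   [e > m]. *)
move=> nd; pose m := (\max_(i < n) \max_(j < n) size (\adj (char_poly_mx L) i j))%N.
have big e : (m <= e)%N -> adj_coef L e = 0.
  move=> me; apply/matrixP => i j; rewrite /adj_coef [LHS]mxE [RHS]mxE.
  rewrite nth_default// (leq_trans _ me)// /m.
  apply: (bigop.bigmax_sup i) => //; apply: (bigop.bigmax_sup j) => //.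
suff H e : adj_coef L (d + m - e) = 0 \/ (d + m < d + e)%N.
  case: (H m); rewrite ?addnK// => /=; by rewrite ltnn.
elim: e => [|e [IH|IH]]; [left|..]; last by right; lia.
  by rewrite subn0 big// leq_addl.
case: (ltnP (d + m) (d + e.+1)); [by right|move=> h; left].
rewrite adj_coefS (_ : (d + m - e.+1).+1 = d + m - e)%N; last by lia.
rewrite IH mul0mx addr0 nth_default ?raddf0// size_char_poly; lia.
Qed.

Lemma mxtrace_adj_coef L d : \tr (adj_coef L d) = (char_poly L)`_d.+1 *+ d.+1.
Proof.
rewrite -coef_deriv deriv_char_poly coef_sum.
by apply: eq_bigr => i _; rewrite mxE.
Qed.

End CharPoly.

(** * Newton transformations as coefficients of the adjugate, and their traces *)

Section Newton.
Variables (R : realType) (n : nat).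
Implicit Types (L : 'M[R]_n) (l : 'rV[R]_n).

(** Vieta: in the expanded product, [J] collects the indices whose factor contributes its root,
    which leaves the power [n - #|J|] of ['X]. *)
Lemma coef_prod_XsubC l k : (k <= n)%N ->
  (\prod_(i < n) ('X - (l 0 i)%:P))`_(n - k) = (-1) ^+ k * elem_sym k l.
Proof.
move=> kn.
under eq_bigr do rewrite addrC.
rewrite bigA_distr coef_sum /elem_sym big_distrr [RHS]big_mkcond/=.
apply: eq_bigr => J _.
rewrite (bigID (mem J))/=.
under eq_bigr => i -> do rewrite -polyCN.
under [X in _ * X]eq_bigr => i /negbTE -> do [].
rewrite -rmorph_prod prodr_const mul_polyC coefZ coefXn prodrN.
have Jn : (#|J| <= n)%N by have := max_card (mem J); rewrite card_ord.
have -> : #|predC (mem J)| = (n - #|J|)%N.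
  by have := cardC (mem J); rewrite card_ord => /(canRL (addKn _)).
have -> : (n - k == n - #|J|)%N = (#|J| == k) by apply/eqP/eqP; lia.
by case: eqP => [->|_]; rewrite ?mulr1 ?mulr0.
Qed.

(* The default value 0 of [eigenvalues] makes every sigma k with k > 0 vanish. *)
Lemma eigenvaluesP L k : sigma k.+1 L != 0 ->
  char_poly L = \prod_(i < n) ('X - (eigenvalues L 0 i)%:P).
Proof.
rewrite /sigma /eigenvalues; case: xgetP => [y _ //|_].
rewrite /elem_sym big1 ?eqxx// => I /eqP cI.
have /card_gt0P[i iI] : (0 < #|I|)%N by rewrite cI.
by rewrite (bigD1 i)//= mxE mul0r.
Qed.

Section Split.
Variable L : 'M[R]_n.
Hypothesis Lsplit : char_poly L = \prod_(i < n) ('X - (eigenvalues L 0 i)%:P).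

Lemma sigma_coef k : (k <= n)%N ->
  sigma k L = (-1) ^+ k * (char_poly L)`_(n - k).
Proof.
by move=> kn; rewrite Lsplit coef_prod_XsubC// mulrA -exprMn mulrNN mulr1 expr1n mul1r.
Qed.

(** Up to signs the recursion of [newton] is [adj_coefS]; it starts at the identity because the
    characteristic polynomial is monic. *)
Lemma newton_adj_coef k : (k < n)%N ->
  newton k L = (-1) ^+ k *: adj_coef L (n - k.+1).
Proof.
elim: k => [|k IH] kn /=.
  rewrite expr0 scale1r adj_coefS (_ : (n - 1).+1 = n); last by lia.
  rewrite adj_coef_eq0// mul0mx addr0.
  have := monicP (char_poly_monic L); rewrite lead_coefE size_char_poly /= => ->.
  by [].
rewrite IH ?(ltnW kn)// (adj_coefS L (n - k.+2)) sigma_coef; last by lia.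
rewrite (_ : (n - k.+2).+1 = n - k.+1)%N; last by lia.
by rewrite scalerDr scale_scalar_mx exprS mulN1r -scalemxAl scaleNr.
Qed.

(** This is Cayley-Hamilton: at degree 0, [coef_adj_mul] has no term of lower degree. *)
Lemma newton_size : (0 < n)%N -> newton n L = 0.
Proof.
case: n L Lsplit newton_adj_coef sigma_coef => // m L' Ls H1 H2 _ /=.
rewrite H1// H2// subnn.
have := coef_adj_mul L' 0; rewrite sub0r => /(canRL (@opprK _)) h.
rewrite -scalemxAl h exprS mulN1r mulNr raddfN /=.
by rewrite scalerN opprK -scale_scalar_mx addNr.
Qed.

(** The trace of the adjugate is the derivative of the characteristic polynomial, whence the factor
    [n - k]. *)
Lemma mxtrace_newton k : (k <= n)%N -> (0 < n)%N ->
  \tr (newton k L) = (n - k)%:R * sigma k L.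
Proof.
move=> kn n0; have [{}kn|kn'] := ltnP k n; last first.
  have -> : k = n by apply/eqP; rewrite eqn_leq kn.
  by rewrite newton_size// mxtrace0 subnn mul0r.
rewrite newton_adj_coef// mxtraceZ mxtrace_adj_coef sigma_coef 1?ltnW//.
rewrite (_ : (n - k.+1).+1 = n - k)%N; last by lia.
by rewrite -mulr_natl; ring.
Qed.

(** Take traces in the recursion defining [newton k.+1 L]; for [k.+1 = n] this relies on
    Cayley-Hamilton. *)
Lemma mxtrace_newton_mul k : (k < n)%N ->
  \tr (newton k L *m L) = k.+1%:R * sigma k.+1 L.
Proof.
move=> kn; have /= := mxtrace_newton kn (leq_ltn_trans (leq0n _) kn).
rewrite raddfB/= mxtrace_scalar natrB// => /(canRL (subrK _)).
by rewrite -mulr_natl => h; lra.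
Qed.

End Split.
End Newton.

(** * Traces of Hessians on the tangent hyperplane *)

Section Dot.
Variables (R : realType) (m : nat).
Implicit Types u v w : 'rV[R]_m.

Lemma dot_mul u v : dot u v = (u *m v^T) 0 0.
Proof. by rewrite mxE; apply: eq_bigr => i _; rewrite mxE. Qed.

Lemma dotC u v : dot u v = dot v u.
Proof. by apply: eq_bigr => i _; rewrite mulrC. Qed.

Lemma dotDl u v w : dot (u + v) w = dot u w + dot v w.
Proof. by rewrite !dot_mul mulmxDl mxE. Qed.

Lemma dotDr u v w : dot w (u + v) = dot w u + dot w v.
Proof. by rewrite ![dot w _]dotC dotDl. Qed.

Lemma dotZl c u v : dot (c *: u) v = c * dot u v.
Proof. by rewrite !dot_mul -scalemxAl mxE. Qed.

Lemma dotZr c u v : dot u (c *: v) = c * dot u v.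
Proof. by rewrite dotC dotZl dotC. Qed.

Lemma dotNl u v : dot (- u) v = - dot u v.
Proof. by rewrite -scaleN1r dotZl mulN1r. Qed.

Lemma dotNr u v : dot u (- v) = - dot u v.
Proof. by rewrite dotC dotNl dotC. Qed.

Lemma dot0l v : dot 0 v = 0.
Proof. by rewrite -(scale0r 0) dotZl mul0r. Qed.

Lemma dot_ge0 u : 0 <= dot u u.
Proof. by apply: sumr_ge0 => i _; rewrite -expr2 sqr_ge0. Qed.

Lemma dot_eq0 u : (dot u u == 0) = (u == 0).
Proof.
apply/idP/eqP => [|->]; last by rewrite dot0l.
rewrite /dot psumr_eq0 => [/allP h|i _]; last by rewrite -expr2 sqr_ge0.
apply/rowP => i; have := h i (mem_index_enum i).
by rewrite /= -expr2 sqrf_eq0 mxE => /eqP.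
Qed.

Lemma dot_gt0 u : (0 < dot u u) = (u != 0).
Proof. by rewrite lt_def dot_eq0 dot_ge0 andbT. Qed.

Lemma dot_colinear u v : u = dot u v *: v -> dot u u = dot u v ^+ 2.
Proof. by move=> h; rewrite {2}h dotZr expr2. Qed.

Lemma enorm_sqr u : enorm u ^+ 2 = dot u u.
Proof. by rewrite sqr_sqrtr// dot_ge0. Qed.

(** The squared length of the part of [u] orthogonal to [v]. It yields Cauchy-Schwarz and, later, a
    strict inequality when [u] is not a multiple of [v]. *)
Lemma dot_orth u v : v != 0 ->
  dot u u - dot u v ^+ 2 / dot v v =
  dot (u - (dot u v / dot v v) *: v) (u - (dot u v / dot v v) *: v).
Proof.
rewrite -dot_gt0 => v0.
rewrite !(dotDl, dotDr, dotNl, dotNr, dotZl, dotZr) (dotC v u).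
by field; rewrite gt_eqF.
Qed.

Lemma CauchySchwarz_dot u v : dot u v ^+ 2 <= dot u u * dot v v.
Proof.
have [->|v0] := eqVneq v 0; first by rewrite dotC !dot0l expr0n/= mulr0.
have := dot_orth u v0; have := dot_ge0 (u - (dot u v / dot v v) *: v).
by move=> + h; rewrite -h subr_ge0 ler_pdivrMr ?dot_gt0.
Qed.

End Dot.

(** * Traces of products of nonnegative forms *)

Section Psd.
Variables (R : realType) (n : nat).
Implicit Types (Q H : 'M[R]_n) (v : 'rV[R]_n).

Definition psd H := forall v, 0 <= dot (v *m H) v.

Lemma psd_row_eq0 H i : H^T = H -> psd H -> H i i = 0 -> forall j, H i j = 0.
Proof.
move=> Hs Hp hii j; apply/eqP/negP => /negP hij.
have hji : H j i = H i j by rewrite -{1}Hs mxE.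
(* As [H i i = 0], the form at [t e_i + e_j] is affine in [t] with slope [2 * H i j]; this [t] gives
   it the value -1. *)
pose t := - (H j j + 1) / (2 * H i j).
have := Hp (t *: delta_mx 0 i + delta_mx 0 j).
rewrite mulmxDl -scalemxAl -!rowE dot_mul linearD linearZ /= !trmx_delta.
rewrite mulmxDr mulmxDl -!scalemxAr -!scalemxAl.
rewrite mulmxDl -!scalemxAl -!colE !mxE hii hji.
have -> : t * (t * 0) + t * H i j + (t * H i j + H j j) = -1 by rewrite /t; field.
by rewrite ler0N1.
Qed.

(* Induction on a list [s] of indices carrying the nonzero rows of [H]: the Schur
   complement of [H i i] removes the index [i]. *)
Lemma mxtrace_psd Q H : psd Q -> H^T = H -> psd H -> 0 <= \tr (Q *m H).
Proof.
move=> Qp; suff ind (s : seq 'I_n) : forall H, H^T = H -> psd H ->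
    (forall i j, i \notin s -> H i j = 0) -> 0 <= \tr (Q *m H).
  by move=> Hs Hp; apply: (ind (enum 'I_n)) => // i j; rewrite mem_enum.
elim: s => [|i s IH] {}H Hs Hp Hz.
  rewrite (_ : H = 0) ?mulmx0 ?mxtrace0//.
  by apply/matrixP => i j; rewrite Hz ?mxE.
have [hii|hii] := eqVneq (H i i) 0.
  apply: IH => // k j ks; have [->|ki] := eqVneq k i; first exact: psd_row_eq0.
  by apply: Hz; rewrite inE negb_or ki.
set c := H i i in hii; pose h := row i H.
have hT : H *m (delta_mx 0 i)^T = h^T.
  by rewrite -[LHS]trmxK trmx_mul trmxK Hs -rowE.
have c_gt0 : 0 < c.
  rewrite lt_def hii; have := Hp (delta_mx 0 i).
  by rewrite -rowE dotC dot_mul -rowE !mxE.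
pose H' := H - c^-1 *: (h^T *m h).
have Hs' : H'^T = H' by rewrite /H' linearB linearZ/= trmx_mul trmxK Hs.
have Hp' : psd H'.
  (* Moving [v] along [e_i] to the minimum of the form of [H] turns that form into the form of [H']
     at [v]. *)
  move=> v; have := Hp (v - (c^-1 * dot v h) *: delta_mx 0 i).
  rewrite mulmxBl -scalemxAl -rowE -/h !(dotDl, dotDr, dotNl, dotNr, dotZl, dotZr).
  have -> : dot (v *m H) (delta_mx 0 i) = dot v h.
    by rewrite !dot_mul -mulmxA hT.
  have -> : dot h (delta_mx 0 i) = c by rewrite dotC dot_mul -rowE !mxE.
  rewrite mulmxBr -scalemxAr mulmxA dotDl dotNl dotZl (dotC h v).
  have -> : v *m h^T *m h = dot v h *: h.
    by rewrite dot_mul -mul_scalar_mx -mx11_scalar.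
  rewrite dotZl (dotC h v).
  by congr (_ <= _); field.
have := IH H' Hs' Hp'; rewrite mulmxBr raddfB/= -scalemxAr mxtraceZ.
have -> : \tr (Q *m (h^T *m h)) = dot (h *m Q) h.
  by rewrite mulmxA mxtrace_mulC mulmxA dot_mul /mxtrace big_ord1.
have := Qp h; rewrite -(pmulr_rge0 _ (_ : 0 < c^-1)) ?invr_gt0// => q0 h'.
suff h0 : 0 <= \tr (Q *m H) - c^-1 * dot (h *m Q) h by lra.
apply: h' => k j ks.
have -> : H' k j = H k j - c^-1 * (H i k * H i j) by rewrite !mxE big_ord1 !mxE.
have [->|ki] := eqVneq k i; first by rewrite -/c mulrA mulVf ?mul1r ?subrr.
have ks' : k \notin i :: s by rewrite inE negb_or ki.
have -> : H i k = 0 by rewrite -Hs mxE Hz.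
by rewrite Hz// mul0r mulr0 subr0.
Qed.

End Psd.

Section Tangent.
Variables (R : realType) (n : nat).
Variables (J : 'M[R]_(n, n.+1)) (nu : 'rV[R]_n.+1).
Hypotheses (J_free : row_free J) (nu1 : dot nu nu = 1).
Hypothesis Jnu : forall v : 'rV[R]_n, dot (v *m J) nu = 0.

(** The hyperplane orthogonal to [nu] contains the row space of [J] and has the same dimension [n],
    so the two coincide. *)
Lemma orth_normal_sub m (M : 'M[R]_(m, n.+1)) :
  (forall v : 'rV[R]_m, dot (v *m M) nu = 0) -> (M <= J)%MS.
Proof.
have ker p (K : 'M[R]_(p, n.+1)) : (forall v : 'rV_p, dot (v *m K) nu = 0) ->
    (K <= kermx nu^T)%MS.
  move=> h; apply/sub_kermxP/row_matrixP => i; rewrite row0.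
  apply/rowP => j; rewrite !ord1 row_mul rowE.
  by have := h (delta_mx 0 i); rewrite dot_mul => ->; rewrite mxE.
move=> /ker Mk; apply: (submx_trans Mk).
have [_ <-] := mxrank_leqif_sup (ker _ _ Jnu).
have nu0 : nu != 0 by rewrite -dot_eq0 nu1 oner_eq0.
by rewrite mxrank_ker mxrank_tr rank_rV nu0 subn1 (eqP J_free).
Qed.

Lemma tangent_decomp w : exists c : 'rV[R]_n, w = c *m J + dot w nu *: nu.
Proof.
have : (w - dot w nu *: nu <= J)%MS.
  apply: orth_normal_sub => v; rewrite (mx11_scalar v) mul_scalar_mx.
  by rewrite dotZl dotDl dotNl dotZl nu1; ring.
by case/submxP => c h; exists c; rewrite -h subrK.
Qed.

(** The tangential part of such a [w] is orthogonal to itself. *)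
Lemma normal_colinear w : (forall v : 'rV[R]_n, dot w (v *m J) = 0) ->
  w = dot w nu *: nu.
Proof.
move=> h; have [c wE] := tangent_decomp w.
suff : dot (c *m J) (c *m J) == 0.
  by rewrite dot_eq0 => /eqP c0; rewrite {1}wE c0 add0r.
by have := h c; rewrite {1}wE dotDl dotZl (dotC nu) Jnu mulr0 addr0 => ->.
Qed.

Let g := J *m J^T.

Lemma gram_unit : g \in unitmx.
Proof.
rewrite -row_free_unit; apply: inj_row_free => v vg.
apply/eqP; rewrite -(mulmx_free_eq0 _ J_free) -dot_eq0 dot_mul trmx_mul mulmxA.
by rewrite -(mulmxA v) vg mul0mx mxE.
Qed.

(** The last hypothesis says that a Hessian is nonnegative on tangent vectors. Its trace against [P]
    is then nonnegative, and coercivity bounds the contribution of [tau] by [delta] times the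
    squared tangential part of [a]. *)
Lemma mxtrace_hessian (N : 'M[R]_(n, n.+1)) (P L : 'M[R]_n) (a : 'rV[R]_n.+1)
    (delta s tau beta : R) :
  N = L *m J -> (N *m J^T)^T = N *m J^T ->
  0 <= delta -> 0 <= tau ->
  (forall v : 'rV[R]_n, delta * dot (v *m J) (v *m J) <= dot (v *m P *m J) (v *m J)) ->
  (forall v : 'rV[R]_n, 0 <= s * dot (v *m J) (v *m J) - tau * dot (v *m J) a ^+ 2
     - beta * dot (v *m J) (v *m N)) ->
  0 <= s * \tr P - tau * delta * (dot a a - dot a nu ^+ 2) - beta * \tr (P *m L).
Proof.
move=> NE Nsym d0 t0 Pco Hge.
have dJ (u v : 'rV[R]_n) : dot (u *m J) (v *m J) = dot (u *m g) v.
  by rewrite !dot_mul trmx_mul !mulmxA.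
have gT : g^T = g by rewrite trmx_mul trmxK.
have [c aE] := tangent_decomp a; pose b := a *m J^T.
have bE : b = c *m g.
  apply/rowP => i; rewrite /b {1}aE mulmxDl -scalemxAl -mulmxA.
  suff -> : nu *m J^T = 0 by rewrite scaler0 addr0.
  apply/rowP => j; rewrite [RHS]mxE -(Jnu (delta_mx 0 j)) dotC dot_mul -rowE.
  by rewrite mxE [RHS]mxE; apply: eq_bigr => k _; rewrite !mxE.
have atan : dot a a - dot a nu ^+ 2 = dot (c *m g) c.
  rewrite {1 2}aE dotDl !dotDr !dotZl !dotZr dJ (dotC nu) Jnu nu1; ring.
pose H := s *: g - tau *: (b^T *m b) - beta *: (N *m J^T).
have Hs : H^T = H.
  rewrite /H !linearB !linearZ/=.
  by rewrite Nsym gT trmx_mul trmxK.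
have Hp : psd H.
  move=> v; apply: le_trans (Hge v) _; rewrite le_eqVlt; apply/orP; left; apply/eqP.
  rewrite !mulmxBr -!scalemxAr !(dotDl, dotNl, dotZl) -dJ.
  rewrite (dotC (v *m J) (v *m N)).
  have -> : dot (v *m (N *m J^T)) v = dot (v *m N) (v *m J).
    by rewrite !dot_mul trmx_mul !mulmxA.
  suff -> : dot (v *m (b^T *m b)) v = dot (v *m J) a ^+ 2 by [].
  have -> : v *m (b^T *m b) = dot v b *: b.
    by rewrite mulmxA dot_mul -mul_scalar_mx -mx11_scalar.
  rewrite dotZl (dotC b) expr2.
  by rewrite !dot_mul /b trmx_mul trmxK mulmxA.
(* The form of [Q] at [w] is that of [P] on the tangent vector with coordinates [w *m invmx g], so
   coercivity bounds it below; the factor [invmx g] also cancels the Gram matrix inside [H]. *)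
pose Q := invmx g *m P.
have QE w : delta * dot (w *m invmx g) w <= dot (w *m Q) w.
  have := Pco (w *m invmx g); rewrite !dJ mulmxKV ?gram_unit// dotC.
  move/le_trans; apply; rewrite le_eqVlt; apply/orP; left; apply/eqP.
  by rewrite -dJ dotC dJ mulmxKV ?gram_unit// dotC mulmxA.
have ginv w : 0 <= dot (w *m invmx g) w.
  have := dot_ge0 (w *m invmx g *m J); rewrite dJ mulmxKV ?gram_unit//.
  by rewrite dotC.
have Qp : psd Q.
  by move=> w; apply: le_trans (QE w); rewrite mulr_ge0.
have := mxtrace_psd Qp Hs Hp.
rewrite /H !mulmxBr !raddfB/= -!scalemxAr !mxtraceZ NE -(mulmxA L) -/g.
have trg (M : 'M[R]_n) : \tr (invmx g *m M *m g) = \tr M.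
  by rewrite mxtrace_mulC mulmxA mulmxV ?gram_unit// mul1mx.
rewrite {1}/Q trg.
have -> : \tr (Q *m (L *m g)) = \tr (P *m L).
  by rewrite mulmxA /Q -(mulmxA (invmx g) P L) trg.
have -> : \tr (Q *m (b^T *m b)) = dot (b *m Q) b.
  by rewrite mulmxA mxtrace_mulC mulmxA dot_mul /mxtrace big_ord1.
have := QE b; rewrite {1}bE mulmxK ?gram_unit// dotC {1}bE -atan => h.
have := ler_wpM2l t0 h; lra.
Qed.

End Tangent.

(** * Second derivatives along lines and symmetry of mixed derivatives *)

Lemma is_derive_derivable (R : numFieldType) (V W : normedModType R) (f : V -> W)
  (a v : V) (df : W) : is_derive a v f df -> derivable f a v.
Proof. by case. Qed.

Lemma is_deriveE (R : numFieldType) (V W : normedModType R) (f : V -> W)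
  (a v : V) (df : W) : is_derive a v f df -> 'D_v f a = df.
Proof. by case. Qed.

Section Lines.
Variables (R : realType) (V : normedModType R).

Lemma is_derive_line (W : normedModType R) (f : V -> W) (u v : V) (t : R) df :
  is_derive (u + t *: v) v f df ->
  is_derive t 1 (fun s : R => f (u + s *: v)) df.
Proof.
have E : (fun h : R => h^-1 *: (((fun s : R => f (u + s *: v)) \o shift t) (h *: 1)
      - f (u + t *: v))) =
    (fun h : R => h^-1 *: ((f \o shift (u + t *: v)) (h *: v) - f (u + t *: v))).
  apply/funext => h /=; congr (_ *: (f _ - _)).
  by rewrite scalerDl -scalerA scale1r addrCA addrA.
by move=> [fd <-]; split; [rewrite /derivable E | rewrite /derive E].
Qed.

Lemma MVT_line (f : V -> R) (u v : V) (h : R) : 0 < h ->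
  (forall t, 0 <= t <= h -> derivable f (u + t *: v) v) ->
  exists2 s, 0 < s < h & f (u + h *: v) - f u = h * 'D_v f (u + s *: v).
Proof.
move=> h0 fd; pose g (t : R) := f (u + t *: v).
have gd t : 0 <= t <= h -> is_derive t 1 g ('D_v f (u + t *: v)).
  by move=> th; apply: is_derive_line; apply/derivableP/fd.
have [| |s] := @MVT R g (fun t => 'D_v f (u + t *: v)) 0 h h0.
- by move=> t; rewrite in_itv/= => /andP[t0 th]; apply: gd; rewrite !ltW.
- apply: derivable_within_continuous => t; rewrite in_itv/= => th.
  exact: is_derive_derivable (gd t th).
rewrite in_itv/= subr0 => sh; rewrite /g scale0r addr0 => e.
by exists s => //; rewrite e mulrC.
Qed.

Lemma near_line (u v : V) (P : set V) : nbhs u P ->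
  \forall t \near (0 : R), P (u + t *: v).
Proof.
move=> uP; have c : (fun t : R => u + t *: v) t @[t --> (0 : R)] --> u.
  rewrite -[X in _ --> X]addr0 -[X in _ --> _ + X](scale0r v); apply: cvgD; first exact: cvg_cst.
  by apply: cvgZr_tmp; exact: cvg_id.
exact: c.
Qed.

End Lines.

Lemma near_pos (R : realType) (P : set R) : (\forall t \near (0 : R), P t) ->
  exists2 e : R, 0 < e & forall t, `|t| <= e -> P t.
Proof.
move=> /nbhs_ballP[e /= e0 eP]; exists (e / 2); first by rewrite divr_gt0.
move=> t te; apply: eP; rewrite /ball/= sub0r normrN (le_lt_trans te)//.
by rewrite ltr_pdivrMr// mulr2n mulrDr mulr1 ltrDl.
Qed.

Section SecondDerivative.
Variable R : realType.

(** If [c < 0], the difference quotients of [dphi] at 0 are negative, so [dphi < 0] just to the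
    right of 0, and the mean value theorem gives [phi h < phi 0]. *)
Lemma second_derivative_test (phi dphi : R -> R) (c : R) :
  (\forall t \near (0 : R), is_derive t (1 : R) phi (dphi t)) ->
  is_derive (0 : R) (1 : R) dphi c ->
  (\forall t \near (0 : R), phi 0 <= phi t) -> dphi 0 = 0 /\ 0 <= c.
Proof.
move=> phid dphid phimin.
have [e e0 eP] := near_pos (filterI phid phimin).
have dphi0 : dphi 0 = 0.
  have d0 : is_derive (0 : R) (1 : R) phi (dphi 0) by case: (eP 0) => //; rewrite normr0 ltW.
  rewrite -(derive_val (is_derive := d0)).
  suff d1 : is_derive (0 : R) (1 : R) phi 0 by rewrite derive_val.
  apply: (@derive1_at_min _ phi (- e) e).
  - by rewrite ge0_cp// ltW.
  - move=> t; rewrite in_itv/= => /andP[t1 t2]; apply: is_derive_derivable.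
    by case: (eP t) => //; rewrite ler_norml !ltW.
  - by rewrite in_itv/= oppr_lt0 e0.
  - move=> t; rewrite in_itv/= => /andP[t1 t2].
    by case: (eP t) => //; rewrite ler_norml !ltW.
split=> //; rewrite leNgt; apply/negP => c0.
have [/cvg_ex[/= l hl] dE] := dphid.
have {}hl : (fun h => h^-1 *: ((dphi \o shift 0) (h *: 1) - dphi 0)) h @[h --> 0^'] --> c.
  by rewrite -dE /derive; move/cvg_lim : (hl) => ->.
have H : \forall h \near (0 : R)^', h^-1 *: ((dphi \o shift 0) (h *: 1) - dphi 0) < 0.
  exact: cvgr_lt hl _ c0.
rewrite near_withinE in H.
have [e' e'0 e'P] := near_pos H.
pose h := Num.min e e'; have h0 : 0 < h by rewrite lt_min e0.
have [||s] := @MVT R phi dphi 0 h h0.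
- move=> t; rewrite in_itv/= => /andP[t0 th].
  case: (eP t) => //; rewrite gtr0_norm// (le_trans (ltW th))// ge_min lexx//.
- apply: derivable_within_continuous => t; rewrite in_itv/= => /andP[t0 th].
  apply: is_derive_derivable; case: (eP t) => //; rewrite ger0_norm// (le_trans th)//.
  by rewrite ge_min lexx.
rewrite in_itv/= subr0 => /andP[s0 sh] e1.
have : phi 0 <= phi h by case: (eP h) => //; rewrite gtr0_norm// ge_min lexx.
rewrite -subr_ge0 e1 pmulr_lge0// leNgt => /negP; apply.
have /= := e'P s; rewrite gtr0_norm// (le_trans (ltW sh)) ?ge_min ?lexx ?orbT//.
rewrite gt_eqF// => /(_ isT isT); rewrite dphi0 subr0 addr0 /GRing.scale/= mulr1.
by rewrite pmulr_rlt0// invr_gt0.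
Qed.

End SecondDerivative.

Section Schwarz.
Variables (R : realType) (V : normedModType R).

Let parallelogram (f : V -> R) (u v w : V) (h : R) :=
  f (u + h *: w + h *: v) - f (u + h *: w) - (f (u + h *: v) - f u).

(** The mean value theorem is used twice: along [v] for the increment of [f] in direction [w], then
    along [w] for ['D_v f]. *)
Let parallelogram_mvt (f : V -> R) (u v w : V) (h : R) : 0 < h ->
  (forall s t, 0 <= s <= h -> 0 <= t <= h ->
     derivable f (u + t *: w + s *: v) v /\
     derivable ('D_v f) (u + s *: v + t *: w) w) ->
  exists s t, [/\ 0 < s < h, 0 < t < h &
    parallelogram f u v w h = h * (h * 'D_w ('D_v f) (u + s *: v + t *: w))].
Proof.
move=> h0 fd.
pose F (p : V) := f (p + h *: w) - f p.
have hh : 0 <= h <= h by rewrite lexx ltW.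
have oh : 0 <= (0 : R) <= h by rewrite lexx ltW.
have Fd (p : V) : derivable f (p + h *: w) v -> derivable f p v ->
    is_derive p v F ('D_v f (p + h *: w) - 'D_v f p).
  move=> d1 d2; apply: is_deriveB; last exact: derivableP.
  have [] := derivableP d1 => a b.
  have E : (fun k : R => k^-1 *: (((fun q => f (q + h *: w)) \o shift p) (k *: v)
      - f (p + h *: w))) =
    (fun k : R => k^-1 *: ((f \o shift (p + h *: w)) (k *: v) - f (p + h *: w))).
    by apply/funext => k /=; rewrite addrA.
  by split; [rewrite /derivable E | rewrite /derive E].
have [|s sh Es] := @MVT_line R V F u v h h0.
- move=> t th; apply: is_derive_derivable; apply: Fd.
    by have [+ _] := fd t h th hh; rewrite addrAC.
  by have [+ _] := fd t 0 th oh; rewrite scale0r addr0.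
have sh' : 0 <= s <= h by case/andP: sh => *; rewrite !ltW.
have [|t th Et] := @MVT_line R V ('D_v f) (u + s *: v) w h h0.
- by move=> t th; have [_] := fd s t sh' th.
exists s, t; split => //; rewrite -Et.
rewrite -(is_deriveE (Fd (u + s *: v) _ _)).
- by rewrite -Es /F /parallelogram (addrAC u (h *: w)); ring.
- by have [+ _] := fd s h sh' hh; rewrite addrAC.
- by have [+ _] := fd s 0 sh' oh; rewrite scale0r addr0.
Qed.

(** The second difference of [f] is symmetric in [v] and [w]. By [parallelogram_mvt] the two mixed
    derivatives thus agree at two points close to [u], and continuity at [u] finishes. *)
Lemma schwarz (f : V -> R) (u v w : V) (U : set V) : nbhs u U ->
  (forall p, U p -> derivable f p v /\ derivable f p w) ->
  (forall p, U p -> derivable ('D_v f) p w /\ derivable ('D_w f) p v) ->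
  {for u, continuous ('D_w ('D_v f))} ->
  {for u, continuous ('D_v ('D_w f))} ->
  'D_w ('D_v f) u = 'D_v ('D_w f) u.
Proof.
move=> uU d1 d2 c1 c2; apply/eqP; rewrite -subr_eq0 -normr_eq0 eq_le normr_ge0 andbT.
apply/ler_addgt0Pl => e e0; rewrite addr0.
have e2 : 0 < e / 2 by rewrite divr_gt0.
move/cvgrPdist_lt : c1 => /(_ _ e2) c1; move/cvgrPdist_lt : c2 => /(_ _ e2) c2.
have [r /= r0 rP] := (nbhs_ballP _ _).1 (filterI uU (filterI c1 c2)).
(* For [s, t <= h] the point [u + s *: v + t *: w] stays in the ball of radius [r]; the added 1
   keeps the denominator positive. *)
pose h := r / (2 * (`|v| + `|w| + 1)).
have nvw : 0 < 2 * (`|v| + `|w| + 1) :> R by rewrite mulr_gt0// ltr_wpDl ?addr_ge0.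
have h0 : 0 < h by rewrite divr_gt0.
have hP s t : 0 <= s <= h -> 0 <= t <= h -> ball u r (u + s *: v + t *: w).
  move=> /andP[s0 sh] /andP[t0 th]; rewrite -ball_normE/= -addrA opprD addNKr normrN.
  rewrite (le_lt_trans (ler_normD _ _))// !normrZ !ger0_norm//.
  have : s * `|v| + t * `|w| <= h * `|v| + h * `|w| by rewrite lerD// ler_wpM2r.
  move=> /le_lt_trans; apply.
  rewrite -mulrDr /h mulrAC ltr_pdivrMr// ltr_pM2l//.
  by have := normr_ge0 v; have := normr_ge0 w; lra.
have [|s1 [t1 [sh1 th1 E1]]] := @parallelogram_mvt f u v w h h0.
  move=> s t sh th; split; last by apply: (d2 _ _).1; exact: (rP _ (hP _ _ sh th)).1.
  by apply: (d1 _ _).1; rewrite addrAC; exact: (rP _ (hP _ _ sh th)).1.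
have [|s2 [t2 [sh2 th2 E2]]] := @parallelogram_mvt f u w v h h0.
  move=> s t sh th; split.
    by apply: (d1 _ _).2; exact: (rP _ (hP _ _ th sh)).1.
  by apply: (d2 _ _).2; rewrite addrAC; exact: (rP _ (hP _ _ th sh)).1.
have wk a : 0 < a < h -> 0 <= a <= h by case/andP=> *; rewrite !ltW.
have [_ [/= L1 _]] := rP _ (hP _ _ (wk _ sh1) (wk _ th1)).
have [_ [/= _ L2]] := rP _ (hP _ _ (wk _ th2) (wk _ sh2)).
have E : 'D_w ('D_v f) (u + s1 *: v + t1 *: w) = 'D_v ('D_w f) (u + t2 *: v + s2 *: w).
  have hn : h != 0 by rewrite gt_eqF.
  apply: (mulfI hn); apply: (mulfI hn); rewrite -E1 (addrAC u) -E2 /parallelogram.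
  by rewrite (addrAC u) -!addrA; congr (_ + _); rewrite !opprB; ring.
rewrite -E in L2.
rewrite [leRHS]splitr.
set Dp := 'D_w _ (_ + _ + _) in L1 L2.
apply: le_trans (ler_distD Dp _ _) _.
apply: lerD; first exact: (ltW L1).
by rewrite distrC; exact: (ltW L2).
Qed.

End Schwarz.

(** * Smooth patches of hypersurfaces *)

Lemma near_eq_continuous (T T' : topologicalType) (f g : T -> T') (p : T) :
  (\forall q \near p, g q = f q) -> {for p, continuous g} -> {for p, continuous f}.
Proof.
move=> gf gc; have e : g p = f p := nbhs_singleton gf.
have h : f @ p --> g p by apply: cvg_trans gc; exact: near_eq_cvg.
by rewrite e in h.
Qed.

Lemma continuous_bigsum (R : numFieldType) (V : normedModType R) (T : topologicalType)
    n (F : 'I_n -> T -> V) (p : T) :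
  (forall i, {for p, continuous (F i)}) -> {for p, continuous (fun q => \sum_i F i q)}.
Proof.
move=> Fc; rewrite /prop_for /continuous_at.
elim: (index_enum _) => [|i r IH].
  by rewrite big_nil; under eq_cvg do rewrite big_nil; exact: cvg_cst.
rewrite big_cons; under eq_cvg do rewrite big_cons.
by apply: cvgD => //; exact: Fc.
Qed.

Section DotCalculus.
Variables (R : realType) (m : nat).

Lemma continuous_dot (T : topologicalType) (f g : T -> 'rV[R]_m) (p : T) :
  {for p, continuous f} -> {for p, continuous g} ->
  {for p, continuous (fun q => dot (f q) (g q))}.
Proof.
move=> cf cg; apply: continuous_bigsum => i; apply: cvgM.
  by apply: (@continuous_comp _ _ _ f (fun M : 'rV[R]_m => M 0 i)) => //;
    exact: coord_continuous.
by apply: (@continuous_comp _ _ _ g (fun M : 'rV[R]_m => M 0 i)) => //;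
  exact: coord_continuous.
Qed.

Lemma is_derive_dot (V : normedModType R) (f g : V -> 'rV[R]_m) (a v : V) df dg :
  is_derive a v f df -> is_derive a v g dg ->
  is_derive a v (fun p => dot (f p) (g p)) (dot df (g a) + dot (f a) dg).
Proof.
have coord (h : V -> 'rV[R]_m) dh i : is_derive a v h dh ->
    is_derive a v (fun p => h p 0 i) (dh 0 i).
  move=> [hd <-]; split; first exact: (derivable_mxP _ _ _).1.
  by rewrite derive_mx// mxE.
move=> fd gd.
rewrite (_ : (fun p => _) = \sum_(i < m) (fun p => f p 0 i) * (fun p => g p 0 i)).
  apply: is_derive_eq.
  by rewrite /dot -big_split/=; apply: eq_bigr => i _; rewrite /GRing.scale/=; ring.
by apply/funext => p; rewrite fct_sumE.
Qed.

Lemma is_derive_dot_cst (V : normedModType R) (f : V -> 'rV[R]_m) (a v : V) df w :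
  is_derive a v f df -> is_derive a v (fun p => dot (f p) w) (dot df w).
Proof.
move=> fd; apply: is_derive_eq.
  by apply: (@is_derive_dot V f (cst w)); exact: fd || exact: is_derive_cst.
by rewrite /= (dotC _ 0) dot0l addr0.
Qed.

Lemma is_derive_unit_orth (V : normedModType R) (g : V -> 'rV[R]_m) (a v : V) dg :
  is_derive a v g dg -> (forall p, dot (g p) (g p) = 1) -> dot dg (g a) = 0.
Proof.
move=> gd g1; have := is_deriveE (is_derive_dot gd gd).
have -> : (fun p => dot (g p) (g p)) = cst 1 by apply/funext => p; exact: g1.
rewrite derive_cst (dotC (g a)) => h.
by have : dot dg (g a) + dot dg (g a) = 0 by []; lra.
Qed.

End DotCalculus.

Section Smooth.
Variables (R : realType) (n m : nat) (U : set 'rV[R]_n) (f : 'rV[R]_n -> 'rV[R]_m).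
Hypothesis f_smooth : smooth_on U f.

Lemma smooth_on_differentiable u : U u -> differentiable f u.
Proof. exact: (f_smooth 1).1. Qed.

Lemma smooth_on_continuous u : U u -> {for u, continuous f}.
Proof. by move=> Uu; apply/differentiable_continuous/smooth_on_differentiable. Qed.

Lemma smooth_on_derive (i : 'I_n) : smooth_on U ('D_(delta_mx 0 i) f).
Proof. by move=> r; exact: (f_smooth r.+1).2. Qed.

Lemma is_derive_jacobian (u v : 'rV[R]_n) : U u -> is_derive u v f (v *m 'J f u).
Proof.
move=> Uu; rewrite -deriveEjacobian; last exact: smooth_on_differentiable.
exact/derivableP/diff_derivable/smooth_on_differentiable.
Qed.

Lemma mul_jacobian (v u : 'rV[R]_n) : U u ->
  v *m 'J f u = \sum_i v 0 i *: 'D_(delta_mx 0 i) f u.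
Proof.
move=> Uu; rewrite mulmx_sum_row; apply: eq_bigr => i _.
by rewrite deriveEjacobian ?rowE//; exact: smooth_on_differentiable.
Qed.

End Smooth.

Section Jacobian.
Variables (R : realType) (n m : nat) (U : set 'rV[R]_n) (f : 'rV[R]_n -> 'rV[R]_m).
Hypotheses (f_smooth : smooth_on U f) (U_open : open U).

(** The Jacobian is expanded in partial derivatives, since [smooth_on] passes to those. *)
Lemma is_derive_mul_jacobian (v w u : 'rV[R]_n) : U u ->
  is_derive u w (fun p => v *m 'J f p)
    (\sum_(i < n) v 0 i *: (w *m 'J ('D_(delta_mx 0 i : 'rV[R]_n) f) u)).
Proof.
move=> Uu; apply: (@near_eq_is_derive _ _ _
    (\sum_i (v 0 i \*: 'D_(delta_mx 0 i) f))).
  near=> p; rewrite fct_sumE (mul_jacobian f_smooth)//; near: p.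
  exact: open_nbhs_nbhs.
apply: is_derive_sum => i; apply: is_deriveZ.
exact: (is_derive_jacobian (smooth_on_derive f_smooth i)).
Unshelve. all: by end_near. Qed.

Lemma continuous_mul_jacobian (v u : 'rV[R]_n) : U u -> {for u, continuous (fun p => v *m 'J f p)}.
Proof.
move=> Uu; have Unear : nbhs u U by exact: open_nbhs_nbhs.
apply: (@near_eq_continuous _ _ _ (fun p => \sum_i v 0 i *: 'D_(delta_mx 0 i) f p)).
  near=> p; rewrite (mul_jacobian f_smooth)//; near: p; exact: Unear.
apply: (@continuous_bigsum _ _ _ _ (fun i p => v 0 i *: 'D_(delta_mx 0 i) f p)) => i.
apply: (@cvgZl_tmp _ _ _ (nbhs u)).
exact: (smooth_on_continuous (smooth_on_derive f_smooth i)).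
Unshelve. all: by end_near. Qed.

(** Pairing with the fixed vector [w] reduces the vector-valued map to the scalar case. *)
Lemma schwarz_jacobian u i j w : U u ->
  dot ('D_(delta_mx 0 j) ('D_(delta_mx 0 i) f) u) w =
  dot ('D_(delta_mx 0 i) ('D_(delta_mx 0 j) f) u) w.
Proof.
move=> Uu; have Unear p : U p -> nbhs p U by move=> Up; exact: open_nbhs_nbhs.
pose g p := dot (f p) w.
have gd k p : U p -> is_derive p (delta_mx 0 k) g (dot ('D_(delta_mx 0 k) f p) w).
  move=> Up; apply: is_derive_dot_cst; apply/derivableP/diff_derivable.
  exact: smooth_on_differentiable Up.
have gdd k l p : U p -> is_derive p (delta_mx 0 l) ('D_(delta_mx 0 k) g)
    (dot ('D_(delta_mx 0 l) ('D_(delta_mx 0 k) f) p) w).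
  move=> Up; apply: (@near_eq_is_derive _ _ _ (fun p => dot ('D_(delta_mx 0 k) f p) w)).
    near=> q; rewrite (is_deriveE (gd k q _))//; near: q; exact: Unear.
  apply: is_derive_dot_cst; apply/derivableP/diff_derivable.
  exact: smooth_on_differentiable (smooth_on_derive f_smooth k) _ Up.
have gc k l : {for u, continuous ('D_(delta_mx 0 l) ('D_(delta_mx 0 k) g))}.
  apply: (@near_eq_continuous _ _ _
    (fun p => dot ('D_(delta_mx 0 l) ('D_(delta_mx 0 k) f) p) w)).
    near=> q; rewrite (is_deriveE (gdd k l q _))//; near: q; exact: Unear.
  apply: continuous_dot; last exact: cst_continuous.
  apply: smooth_on_continuous Uu.
  exact: (smooth_on_derive (smooth_on_derive f_smooth k) l).
apply: (etrans (esym (is_deriveE (gdd i j u Uu)))).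
apply: etrans (is_deriveE (gdd j i u Uu)).
apply: (schwarz (U := U)); [exact: Unear | | | exact: gc | exact: gc].
  by move=> p Up; split; apply: is_derive_derivable; exact: gd.
by move=> p Up; split; apply: is_derive_derivable; exact: gdd.
Unshelve. all: by end_near. Qed.

End Jacobian.

(** First and second order conditions along a curve for |y|^2/2 - eps exp(alpha <y, a>): [D] is the
    ambient gradient at [c 0], and the ambient Hessian is the identity minus [alpha ^+ 2 * E] times
    the square of the form <., a>. *)
Lemma perturbed_min_path (R : realType) (m : nat) (c dc : R -> 'rV[R]_m)
    (ddc a : 'rV[R]_m) (alpha eps : R) :
  (\forall t \near (0 : R), is_derive t (1 : R) c (dc t)) ->
  is_derive (0 : R) (1 : R) dc ddc ->
  (\forall t \near (0 : R),
     dot (c 0) (c 0) / 2 - eps * expR (alpha * dot (c 0) a) <=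
     dot (c t) (c t) / 2 - eps * expR (alpha * dot (c t) a)) ->
  let E := eps * expR (alpha * dot (c 0) a) in
  let D := c 0 - (alpha * E) *: a in
  dot D (dc 0) = 0 /\
  0 <= dot (dc 0) (dc 0) - alpha ^+ 2 * E * dot (dc 0) a ^+ 2 + dot D ddc.
Proof.
move=> cd dcd cmin E D.
pose e t := expR (alpha * dot (c t) a).
have ed t : is_derive t (1 : R) c (dc t) ->
    is_derive t (1 : R) e (e t * (alpha * dot (dc t) a)).
  move=> Ut; apply: (@is_derive1_comp _ expR (fun t => alpha * dot (c t) a)).
  apply: is_deriveZ; exact/is_derive_dot_cst.
have c0d : is_derive (0 : R) (1 : R) c (dc 0) by exact: nbhs_singleton cd.
pose phi t := dot (c t) (c t) / 2 - eps * e t.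
pose dphi t := dot (c t) (dc t) - eps * (e t * (alpha * dot (dc t) a)).
have [|||d1 d2] := @second_derivative_test R phi dphi
  (dot (dc 0) (dc 0) + dot (c 0) ddc - eps * (e 0 * (alpha * dot ddc a)
    + (alpha * dot (dc 0) a) * (e 0 * (alpha * dot (dc 0) a)))).
- apply: filterS cd => t ct.
  have d1 := is_deriveZ 2^-1 (is_derive_dot ct ct).
  have d2 := is_deriveZ eps (ed t ct).
  rewrite (_ : phi = 2^-1 \*: (fun t => dot (c t) (c t)) - eps \*: e).
    apply: (@is_derive_eq _ _ _ _ _ _ _ _ (is_deriveB d1 d2)).
    by rewrite /dphi (dotC (dc _)) /GRing.scale/=; field.
  by apply/funext => s; rewrite /phi /= mulrC.
- have d1 := is_derive_dot c0d dcd.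
  have d2 := is_deriveZ alpha (is_derive_dot_cst a dcd).
  have d3 := is_deriveZ eps (is_deriveM (ed 0 c0d) d2).
  exact: (@is_derive_eq _ _ _ _ _ _ _ _ (is_deriveB d1 d3)).
- exact: cmin.
split; first by rewrite /D /E dotDl dotNl dotZl (dotC a) -[RHS]d1 /dphi /e; ring.
apply: le_trans d2 _; rewrite le_eqVlt; apply/orP; left; apply/eqP.
by rewrite /D /E dotDl dotNl dotZl (dotC a) /e; ring.
Qed.

Lemma mulmx_trmx_dot (R : realType) (n m : nat) (M N : 'M[R]_(n, m)) a b :
  (M *m N^T) a b = dot (delta_mx 0 a *m M) (delta_mx 0 b *m N).
Proof. by rewrite -!rowE !mxE; apply: eq_bigr => k _; rewrite !mxE. Qed.

(** * Second fundamental form and minimum conditions on a parametrized patch *)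

Section Patch.
Variables (R : realType) (n m : nat) (U : set 'rV[R]_n) (X nu : 'rV[R]_n -> 'rV[R]_m).
Hypotheses (U_open : open U) (X_smooth : smooth_on U X) (nu_smooth : smooth_on U nu).
Hypothesis X_nu : forall p (v : 'rV[R]_n), U p -> dot (v *m 'J X p) (nu p) = 0.

(** Differentiate the identity <dX(v), nu> = 0 in the direction [w]. *)
Lemma second_fundamental_form (v w u : 'rV[R]_n) : U u ->
  dot ('D_w (fun p => v *m 'J X p) u) (nu u) = - dot (v *m 'J X u) (w *m 'J nu u).
Proof.
move=> Uu; apply/eqP; rewrite -subr_eq0 opprK; apply/eqP.
rewrite -(is_deriveE (is_derive_dot (derivableP (is_derive_derivable
  (is_derive_mul_jacobian X_smooth U_open v w Uu)))
  (is_derive_jacobian nu_smooth w Uu))).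
apply: (@is_deriveE _ _ _ _ u w).
apply: (@near_eq_is_derive _ _ _ (cst 0)).
near=> p; rewrite X_nu//; near: p; exact: open_nbhs_nbhs.
Unshelve. all: by end_near. Qed.

(** The entries are, up to sign, normal components of the mixed second derivatives of [X], which
    commute. *)
Lemma second_fundamental_form_sym u : U u ->
  ('J nu u *m ('J X u)^T)^T = 'J nu u *m ('J X u)^T.
Proof.
move=> Uu; apply/matrixP => i j; rewrite mxE.
have E a b : ('J nu u *m ('J X u)^T) a b =
    - dot ('D_(delta_mx 0 a) ('D_(delta_mx 0 b) X) u) (nu u).
  apply: (etrans (mulmx_trmx_dot _ _ _ _)); apply: (etrans (dotC _ _)).
  apply: (canRL (@opprK R)).
  apply: (etrans (esym (second_fundamental_form (delta_mx 0 b) (delta_mx 0 a) Uu))).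
  congr (dot _ _); apply: near_eq_derive; near=> p; rewrite deriveEjacobian//.
  apply: (smooth_on_differentiable X_smooth); near: p; exact: open_nbhs_nbhs.
have S := congr1 -%R (schwarz_jacobian X_smooth U_open i j (nu u) Uu).
exact: (etrans (E j i) (etrans S (esym (E i j)))).
Unshelve. all: by end_near. Qed.

Lemma perturbed_min_orders u (a : 'rV[R]_m) (alpha eps : R) : U u ->
  (\forall p \near u,
     dot (X u) (X u) / 2 - eps * expR (alpha * dot (X u) a) <=
     dot (X p) (X p) / 2 - eps * expR (alpha * dot (X p) a)) ->
  let E := eps * expR (alpha * dot (X u) a) in
  let D := X u - (alpha * E) *: a in
  forall v : 'rV[R]_n, dot D (v *m 'J X u) = 0 /\
    0 <= dot (v *m 'J X u) (v *m 'J X u) - alpha ^+ 2 * E * dot (v *m 'J X u) a ^+ 2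
      + dot D ('D_v (fun p => v *m 'J X p) u).
Proof.
move=> Uu umin E D v.
have l0 : u + 0 *: v = u by rewrite scale0r addr0.
have := @perturbed_min_path _ _ (fun t => X (u + t *: v))
  (fun t => v *m 'J X (u + t *: v)) ('D_v (fun p => v *m 'J X p) u) a alpha eps.
rewrite l0; apply.
- have Ul : \forall t \near (0 : R), U (u + t *: v).
    by apply: near_line; exact: open_nbhs_nbhs.
  apply: filterS Ul => t Ut; apply: is_derive_line.
  exact: (is_derive_jacobian X_smooth).
- apply: (@is_derive_line _ _ _ (fun p => v *m 'J X p)); rewrite l0.
  apply: derivableP.
  exact: is_derive_derivable (is_derive_mul_jacobian X_smooth U_open v v Uu).
- exact: (@near_line _ _ u v _ umin).
Unshelve. all: by end_near. Qed.

End Patch.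

(** * Compactness and local injectivity *)

Section Compactness.
Variables (T : topologicalType) (R : realType) (C : set T).
Hypothesis C_compact : compact C.

(** Continuity is only available at points of [C], so the argument goes through cluster points in
    [C]. *)
Lemma compact_preimage_closed (T' : topologicalType) (f : T -> T') (D : set T') :
  (forall u, C u -> {for u, continuous f}) -> closed D -> compact (C `&` f @^-1` D).
Proof.
move=> fc Dcl F FF FCD.
have [u [Cu Fu]] : C `&` cluster F !=set0.
  by apply: C_compact; apply: filterS FCD; exact: subIsetl.
exists u; split => //; split => //; apply: Dcl => B nB.
have [v [[_ Dv] Bv]] := Fu _ _ FCD (fc _ Cu _ nB).
by exists (f v).
Qed.

Lemma compact_min (f : T -> R) : (forall u, C u -> {for u, continuous f}) ->
  C !=set0 -> exists2 u, C u & forall v, C v -> f u <= f v.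
Proof.
move=> fc C0; have [|u] := compact_EVT_min C0 C_compact (f := f).
  by apply: continuous_in_subspaceT => v /[!inE]; exact: fc.
by rewrite inE => Cu h; exists u => // v Cv; apply: h; rewrite inE.
Qed.

Lemma compact_max (f : T -> R) : (forall u, C u -> {for u, continuous f}) ->
  C !=set0 -> exists2 u, C u & forall v, C v -> f v <= f u.
Proof.
move=> fc C0; have [|u Cu h] := @compact_min (fun v => - f v) _ C0.
  by move=> u Cu; apply: cvgN; exact: fc.
by exists u => // v /h; rewrite lerN2.
Qed.

Lemma compact_pos_lb (f : T -> R) : (forall u, C u -> {for u, continuous f}) ->
  (forall u, C u -> 0 < f u) -> exists2 eta, 0 < eta & forall u, C u -> eta <= f u.
Proof.
move=> fc f0; have [C0|C0] := pselect (C !=set0); last first.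
  by exists 1 => // u Cu; case: C0; exists u.
by have [u Cu h] := compact_min fc C0; exists (f u) => //; exact: f0.
Qed.

(** By compactness the maximum of [g] and [- w] has a lower bound [eta > 0]. Where [- w >= eta] both
    terms help; where [g >= eta], a small [eps] suffices because [w] is bounded above. *)
Lemma compact_perturbation (g w : T -> R) :
  (forall u, C u -> {for u, continuous g}) ->
  (forall u, C u -> {for u, continuous w}) ->
  (forall u, C u -> 0 <= g u) -> (forall u, C u -> g u = 0 -> w u < 0) ->
  exists2 eps, 0 < eps & forall u, C u -> 0 < g u - eps * w u.
Proof.
move=> gc wc g0 gw.
have [|u Cu|eta eta0 etaP] := @compact_pos_lb (fun u => Num.max (g u) (- w u)).
- move=> u Cu; apply: continuous_max; first exact: gc.
  by apply: cvgN; exact: wc.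
- rewrite lt_max; have := g0 u Cu; rewrite le_eqVlt => /orP[/eqP|->//].
  by move=> /esym/(gw u Cu) wu; rewrite oppr_gt0 wu orbT.
have [C0|C0] := pselect (C !=set0); last by exists 1 => // u Cu; case: C0; exists u.
have [v _ wv] := compact_max wc C0.
have B0 : 0 < `|w v| + 1 by rewrite ltr_wpDl.
exists (eta / (`|w v| + 1)) => [|u Cu]; first by rewrite divr_gt0.
have := etaP u Cu; rewrite le_max => /orP[gu|wu]; last first.
  have : 0 <= g u by exact: g0.
  have : 0 < eta / (`|w v| + 1) * (- w u).
    by rewrite mulr_gt0 ?divr_gt0// (lt_le_trans eta0).
  by lra.
rewrite subr_gt0 (lt_le_trans _ gu)//.
apply: (@le_lt_trans _ _ (eta / (`|w v| + 1) * `|w v|)).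
  by rewrite ler_wpM2l ?divr_ge0 ?(ltW eta0) ?(ltW B0)// (le_trans (wv _ Cu))// ler_norm.
by rewrite mulrAC ltr_pdivrMr// ltr_pM2l// ltrDl.
Qed.

End Compactness.

Section Frobenius.
Variable R : realType.

(** The square of the Frobenius norm. *)
Definition frobenius n m (M : 'M[R]_(n, m)) : R := \sum_i dot (row i M) (row i M).

Lemma dot_mulmx_le n m (M : 'M[R]_(n, m)) (y : 'rV[R]_n) :
  dot (y *m M) (y *m M) <= frobenius M * dot y y.
Proof.
have -> : frobenius M = \sum_j dot (col j M)^T (col j M)^T.
  rewrite /frobenius exchange_big/=; apply: eq_bigr => j _; apply: eq_bigr => i _.
  by rewrite !mxE.
rewrite big_distrl; apply: ler_sum => j _ /=.
have -> : (y *m M) 0 j = dot y (col j M)^T.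
  by rewrite mxE; apply: eq_bigr => i _; rewrite !mxE.
by rewrite -expr2 [leRHS]mulrC CauchySchwarz_dot.
Qed.

(** A right inverse of [M] recovers [v] from [v *m M]; adding 1 to its squared norm makes the
    constant positive. *)
Lemma row_free_dot_lb n m (M : 'M[R]_(n, m)) : row_free M ->
  exists2 F : R, 0 < F & forall v : 'rV[R]_n, dot v v <= F * dot (v *m M) (v *m M).
Proof.
move=> Mf; exists (frobenius (pinvmx M) + 1).
  by apply: ltr_wpDl => //; apply: sumr_ge0 => i _; exact: dot_ge0.
move=> v; rewrite -{1 2}(mulmxKp Mf v); apply: le_trans (dot_mulmx_le _ _) _.
by rewrite ler_wpM2r ?dot_ge0// lerDl.
Qed.

Lemma definite_near n m (J0 Ju Jw : 'M[R]_(n, m)) (F : R) (v : 'rV[R]_n) :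
  0 < F -> dot v v <= F * dot (v *m J0) (v *m J0) ->
  frobenius (Ju - J0) < (16 * F)^-1 -> frobenius (Jw - J0) < (16 * F)^-1 ->
  v != 0 -> 0 < dot (v *m Ju) (v *m Jw).
Proof.
move=> F0 pv du dw v0; rewrite -dot_gt0 in v0.
set p := v *m J0 in pv *.
have small J : frobenius (J - J0) < (16 * F)^-1 ->
    dot (v *m J - p) (v *m J - p) <= dot p p / 16.
  move=> dz; rewrite /p -mulmxBr (le_trans (dot_mulmx_le _ _))//.
  apply: (@le_trans _ _ ((16 * F)^-1 * dot v v)).
    by rewrite ler_wpM2r ?dot_ge0// ltW.
  by rewrite invfM -mulrA mulrC ler_pM2r ?invr_gt0// ler_pdivrMl.
have su := small _ du; have sw := small _ dw.
have pp : 0 < dot p p by move: (lt_le_trans v0 pv); rewrite pmulr_rgt0.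
rewrite -[v *m Ju](subrK p) -[v *m Jw](subrK p).
move: (v *m Ju - p) (v *m Jw - p) su sw => a b su sw.
(* With |a|^2 and |b|^2 at most |p|^2/16, these squares bound <a, p> and <b, p> below by -|p|^2/4
   and <a, b> by -|p|^2/16, so <a + p, b + p> is positive. *)
have := dot_ge0 (a + b); have := dot_ge0 (4%:R *: a + p); have := dot_ge0 (4%:R *: b + p).
rewrite !(dotDl, dotDr, dotZl, dotZr) (dotC p a) (dotC p b) (dotC b a).
lra.
Qed.

End Frobenius.

Section LocalInjectivity.
Variables (R : realType) (n m : nat) (U : set 'rV[R]_n) (X : 'rV[R]_n -> 'rV[R]_m).
Hypotheses (U_open : open U) (X_smooth : smooth_on U X).

Lemma jacobian_locally_definite u0 : U u0 -> row_free ('J X u0) ->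
  exists2 r : R, 0 < r & ball u0 r `<=` U /\
    forall u w : 'rV[R]_n, ball u0 r u -> ball u0 r w -> forall v : 'rV[R]_n, v != 0 ->
      0 < dot (v *m 'J X u) (v *m 'J X w).
Proof.
move=> Uu0 Jf; have [F F0 FP] := row_free_dot_lb Jf.
pose d u := frobenius ('J X u - 'J X u0).
have dc : d u @[u --> u0] --> d u0.
  apply: continuous_bigsum => i.
  have rc : {for u0, continuous (fun u => row i ('J X u - 'J X u0))}.
    rewrite (_ : (fun u => _) = fun u => delta_mx 0 i *m 'J X u - row i ('J X u0)).
      apply: (@continuousB _ _ _ (fun p => delta_mx 0 i *m 'J X p)
        (fun=> row i ('J X u0))); last exact: cst_continuous.
      exact: (continuous_mul_jacobian X_smooth U_open Uu0).
    by apply/funext => u; rewrite linearB/= -rowE.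
  by apply: continuous_dot; exact: rc.
have d0 : d u0 = 0.
  rewrite /d subrr /frobenius big1// => i _.
  by rewrite row0 dot0l.
have F16 : d u0 < (16 * F)^-1 by rewrite d0 invr_gt0 mulr_gt0.
have dn : \forall u \near u0, d u < (16 * F)^-1 by exact: cvgr_lt dc _ F16.
have Un : nbhs u0 U by exact: open_nbhs_nbhs.
have [r /= r0 rP] := (nbhs_ballP _ _).1 (filterI Un dn).
exists r => //; split => [u /rP[]//|u w /rP[_ /= du] /rP[_ /= dw] v].
exact: (definite_near F0 (FP v) du dw).
Qed.

(** By the mean value theorem on the segment from [u] to [w], the product is that of the images of
    [w - u] under two nearby Jacobians, positive unless [w = u]. *)
Lemma orthogonal_secant (u0 : 'rV[R]_n) (r : R) : ball u0 r `<=` U ->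
  (forall u w : 'rV[R]_n, ball u0 r u -> ball u0 r w -> forall v : 'rV[R]_n, v != 0 ->
      0 < dot (v *m 'J X u) (v *m 'J X w)) ->
  forall u w : 'rV[R]_n, ball u0 r u -> ball u0 r w ->
    dot (X w - X u) ((w - u) *m 'J X u) = 0 -> w = u.
Proof.
move=> rU rJ u w bu bw h; apply/eqP; rewrite -subr_eq0; apply/negP => /negP wu.
set y := (w - u) *m 'J X u in h.
have seg (t : R) : 0 <= t <= 1 -> ball u0 r (u + t *: (w - u)).
  move=> /andP[t0 t1]; move: bu bw; rewrite -!ball_normE/= => bu bw.
  have -> : u0 - (u + t *: (w - u)) = (1 - t) *: (u0 - u) + t *: (u0 - w).
    by rewrite !scalerBr !scalerBl !scale1r; apply/rowP => i; rewrite !mxE; ring.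
  rewrite (le_lt_trans (ler_normD _ _))// !normrZ !ger0_norm ?subr_ge0//.
  have [->|tn0] := eqVneq t 0; first by rewrite subr0 mul1r mul0r addr0.
  have : t * `|u0 - w| < t * r by rewrite ltr_pM2l// lt_def tn0.
  have : (1 - t) * `|u0 - u| <= (1 - t) * r by rewrite ler_wpM2l ?subr_ge0// ltW.
  lra.
have [|s /andP[s0 s1]] := @MVT_line R _ (fun p => dot (X p) y) u (w - u) 1 ltr01.
  move=> t t01; apply: is_derive_derivable; apply: is_derive_dot_cst.
  exact: (is_derive_jacobian X_smooth (w - u) (rU _ (seg _ t01))).
have bs : ball u0 r (u + s *: (w - u)) by apply: seg; rewrite !ltW.
rewrite (is_deriveE (is_derive_dot_cst y (is_derive_jacobian X_smooth (w - u) (rU _ bs)))).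
have -> : u + 1 *: (w - u) = w by rewrite scale1r addrC subrK.
rewrite mul1r -dotNl -dotDl h => /esym e.
by have /lt_eqF/eqP := rJ _ _ bs bu _ wu; apply; exact: esym e.
Qed.

End LocalInjectivity.

(** * The strong minimum principle *)

Lemma continuous_dist (R : realType) (V : normedModType R) (v u : V) :
  {for u, continuous (fun w : V => `|v - w|)}.
Proof.
rewrite /prop_for /continuous_at; apply: cvg_norm.
by apply: cvgB; [exact: cvg_cst | exact: cvg_id].
Qed.

Lemma continuous_near_gt (R : realType) (T : topologicalType) (g : T -> R) (p : T) (y : R) :
  {for p, continuous g} -> y < g p -> \forall q \near p, y < g q.
Proof. by move=> gc; exact: cvgr_gt gc _. Qed.

Lemma continuous_near_lt (R : realType) (T : topologicalType) (g : T -> R) (p : T) (y : R) :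
  {for p, continuous g} -> g p < y -> \forall q \near p, g q < y.
Proof. by move=> gc; exact: cvgr_lt gc _. Qed.

(** * A patch around a minimum point, with the curvature entering through [hopf] *)

Section MinOpen.
Variables (R : realType) (n m : nat) (u0 : 'rV[R]_n) (r B : R).
Variables (X nu : 'rV[R]_n -> 'rV[R]_m).
Local Notation f u := (dot (X u) (X u)).
Local Notation r2 := (f u0).
Hypotheses (r_gt0 : 0 < r) (B_ge0 : 0 <= B) (r2_gt0 : 0 < r2).
Hypothesis X_cont : forall u : 'rV[R]_n, ball u0 r u -> {for u, continuous X}.
Hypothesis nu_cont : forall u : 'rV[R]_n, ball u0 r u -> {for u, continuous nu}.
Hypothesis X_min : forall u : 'rV[R]_n, ball u0 r u -> r2 <= f u.
Hypothesis X_normal : forall u : 'rV[R]_n, ball u0 r u -> f u = r2 -> X u = dot (X u) (nu u) *: nu u.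
Hypothesis X_ray_inj : forall (u w : 'rV[R]_n) (t : R), ball u0 r u -> ball u0 r w -> f u = r2 ->
  X w = t *: X u -> w = u.
Hypothesis hopf : forall (u : 'rV[R]_n) a (alpha eps : R), ball u0 r u -> 0 < alpha -> 0 < eps ->
  (\forall p \near u, f u / 2 - eps * expR (alpha * dot (X u) a) <=
     f p / 2 - eps * expR (alpha * dot (X p) a)) ->
  alpha * (dot a a - dot a (nu u) ^+ 2) <= B * (dot a a + f u).

Let s := r / 2.
Let s_gt0 : 0 < s. Proof. by rewrite divr_gt0. Qed.
Let W := [set u : 'rV[R]_n | `|u0 - u| <= s].

Let W_compact : compact W.
Proof.
apply: bounded_closed_compact; last first.
  have -> : W = closed_ball u0 s by rewrite closed_ballE.
  exact: closed_ball_closed.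
exists (`|u0| + s); split => [|z hz u Wu]; first exact: num_real.
rewrite /= -(subrK u0 u) (le_trans (ler_normD _ _))// ltW// (le_lt_trans _ hz)//.
by rewrite addrC lerD2l distrC.
Qed.

Let W_ball u : W u -> ball u0 r u.
Proof.
move=> Wu; rewrite -ball_normE/= (le_lt_trans Wu)// ltr_pdivrMr//.
by rewrite mulr_natr mulr2n ltrDl.
Qed.

Let f_cont (u : 'rV[R]_n) : ball u0 r u -> {for u, continuous (fun u : 'rV[R]_n => f u)}.
Proof. by move=> bu; apply: continuous_dot; exact: X_cont. Qed.

Let dotX_cont a (u : 'rV[R]_n) : ball u0 r u ->
  {for u, continuous (fun u : 'rV[R]_n => dot (X u) a)}.
Proof.
move=> bu; apply: continuous_dot; first exact: X_cont.
exact: cst_continuous.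
Qed.

Let dist_cont (u : 'rV[R]_n) : {for u, continuous (fun u : 'rV[R]_n => `|u0 - u|)}.
Proof.
exact: continuous_dist.
Qed.

Let KW := W `&` (fun u : 'rV[R]_n => f u) @^-1` [set y : R | y <= r2].

Let KW_compact : compact KW.
Proof.
apply: (compact_preimage_closed W_compact); last exact: closed_le.
by move=> u /W_ball; exact: f_cont.
Qed.

Let KW_eq u : KW u -> f u = r2.
Proof.
by move=> [Wu /= fu]; apply/eqP; rewrite eq_le fu X_min//; exact: W_ball.
Qed.

Let bdry := KW `&` (fun u : 'rV[R]_n => `|u0 - u|) @^-1` [set y : R | s / 2 <= y].

(** On the sphere of squared radius [r2], the product <X u, X u0> reaches [r2] only if [X u = X u0],
    and then [u = u0] by [X_ray_inj]; compactness makes the gap uniform. *)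
Let bdry_gap : exists2 eta, 0 < eta &
  forall u, bdry u -> eta <= r2 - dot (X u) (X u0).
Proof.
apply: compact_pos_lb.
- apply: (compact_preimage_closed KW_compact); last exact: closed_ge.
  by move=> u _; exact: dist_cont.
- move=> u [[/W_ball bu _] _].
  apply: (@continuousB _ _ _ (fun=> r2)); first exact: cst_continuous.
  exact: dotX_cont.
move=> u [Ku /= su]; have bu := W_ball Ku.1; have fu := KW_eq Ku.
rewrite ltNge; apply/negP => h.
have : dot (X u0 - X u) (X u0 - X u) == 0.
  rewrite eq_le dot_ge0 andbT !(dotDl, dotDr, dotNl, dotNr) fu (dotC (X u0)).
  by lra.
rewrite dot_eq0 subr_eq0 => /eqP e; move: su.
have -> : u0 = u.
  apply: (@X_ray_inj u u0 1 bu _ fu); last by rewrite scale1r.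
  exact: ballxx.
by rewrite subrr normr0 leNgt divr_gt0.
Qed.

(* [bdry] keeps the maximizers of <X, a> over [KW] away from the boundary of [W];
   [theta < 0] describes a neighbourhood of these maximizers, on which [hopf]
   fails for the chosen [alpha]. *)
Lemma min_locally_constant : \forall q \near u0, f q = r2.
Proof.
have b0 : ball u0 r u0 by exact: ballxx.
have K0 : KW u0 by split; rewrite /= ?lexx// /W/= subrr normr0 ltW.
have [eta eta0 etaP] := bdry_gap.
have Q1 : \forall q \near u0, W q.
  apply: filterS (nbhsx_ballx u0 s s_gt0) => q.
  by rewrite -ball_normE /= => /ltW.
have Q2 : \forall q \near u0, 0 < dot (X q) (X u0).
  refine (continuous_near_gt (@dotX_cont (X u0) u0 b0) r2_gt0).
(* [4 * r2] bounds |X u - X u0|^2 on the minimum set, so by Cauchy-Schwarz replacing [X u0] by [X q]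
   changes the products in [bdry_gap] by less than [eta]. *)
have Q3 : \forall q \near u0,
    4 * r2 * dot (X q - X u0) (X q - X u0) < eta ^+ 2.
  have c : {for u0, continuous
      (fun q => 4 * r2 * dot (X q - X u0) (X q - X u0))}.
    apply: (@continuousM _ _ (fun=> 4 * r2)); first exact: cst_continuous.
    by apply: continuous_dot; apply: (@continuousB _ _ _ X (fun=> X u0));
      [exact: X_cont | exact: cst_continuous | exact: X_cont | exact: cst_continuous].
  apply: (continuous_near_lt c).
  by rewrite subrr dot0l mulr0 exprn_gt0.
have FF := nbhs_filter u0.
have Q := @filterI _ _ FF _ _ Q1 (@filterI _ _ FF _ _ Q2 Q3).
apply: (@filterS _ _ FF _ _ _ Q) => q [Wq [q2 q3]].
have bdry_lt u : bdry u -> dot (X u) (X q) < dot (X u0) (X q).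
  move=> bu; have h := etaP u bu; have fu := KW_eq bu.1.
  rewrite -subr_lt0 -dotNl -dotDl -(subrK (X u0) (X q)).
  set D := X u - X u0; set e := X q - X u0.
  have DD : dot D D <= 4 * r2.
    have := dot_ge0 (X u + X u0).
    by rewrite /D !(dotDl, dotDr, dotNl, dotNr) fu (dotC (X u0)); lra.
  have De : dot D e < eta.
    rewrite ltNge; apply/negP => hDe.
    have : dot D e ^+ 2 < eta ^+ 2.
      apply: le_lt_trans q3; apply: le_trans (CauchySchwarz_dot _ _) _.
      by rewrite ler_wpM2r ?dot_ge0.
    by rewrite ltNge ler_sqr ?nnegrE ?(ltW eta0) ?hDe// (le_trans (ltW eta0)).
  have : dot D (X u0) <= - eta by rewrite /D dotDl dotNl; lra.
  by rewrite dotDr; lra.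
apply/eqP/negP => /negP fq.
set a := X q in q2 bdry_lt.
have [|u1 K1 u1max] := compact_max KW_compact (f := fun u => dot (X u) a) _
  (ex_intro _ u0 K0).
  by move=> u [/W_ball bu _]; exact: dotX_cont.
set Mx := dot (X u1) a in u1max.
have b1 := W_ball K1.1; have f1 := KW_eq K1.
(* [psi u] is the squared tangential part of [a] at [u]. At the maximizers [X u] is normal and [psi]
   equals [kappa], which is positive since [a] is not a multiple of [X u1]. *)
pose psi u := dot a a - dot a (nu u) ^+ 2.
pose kappa := dot a a - Mx ^+ 2 / r2.
have X1 : X u1 != 0 by rewrite -dot_gt0 f1.
have kappa_gt0 : 0 < kappa.
  rewrite /kappa /Mx dotC -f1 dot_orth// dot_gt0 subr_eq0; apply/negP => /eqP aE.
  have qu := X_ray_inj b1 (W_ball Wq) f1 aE.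
  by rewrite qu f1 eqxx in fq.
have psi_max u : KW u -> dot (X u) a = Mx -> psi u = kappa.
  move=> Ku e; have fu := KW_eq Ku; have nu_u := X_normal (W_ball Ku.1) fu.
  rewrite /psi /kappa -e -fu; set b := dot (X u) (nu u) in nu_u.
  have fb : f u = b ^+ 2 by exact: dot_colinear nu_u.
  have bn : b != 0 by rewrite -sqrf_eq0 -fb fu gt_eqF.
  rewrite fb {1}nu_u dotZl (dotC (nu u)) exprMn.
  by rewrite [X in _ - X / _]mulrC mulfK// sqrf_eq0.
(* Chosen so that [alpha * (kappa / 2)] exceeds by 1 the right side of [hopf] at points where
   [f u = 4 * r2]. *)
pose alpha := (B * (dot a a + 4 * r2) + 1) * 2 / kappa.
have Bp : 0 < B * (dot a a + 4 * r2) + 1.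
  by rewrite ltr_wpDl// mulr_ge0// addr_ge0 ?dot_ge0// mulr_ge0// dot_ge0.
have alpha_gt0 : 0 < alpha by rewrite divr_gt0// mulr_gt0.
(* [theta u < 0] means that [u] is within [s / 2] of [u0], hence interior to [W], and that
   [psi u > kappa / 2] and [f u < 4 * r2], which contradicts [hopf]. *)
pose theta u := Num.max (Num.max (`|u0 - u| - s / 2) (kappa / 2 - psi u)) (f u - 4 * r2).
have theta_cont u : W u -> {for u, continuous theta}.
  move=> /W_ball bu; apply: continuous_max; last first.
    by apply: (@continuousB _ _ _ (fun u : 'rV[R]_n => f u)); [exact: f_cont|exact: cst_continuous].
  apply: continuous_max.
    by apply: (@continuousB _ _ _ (fun u : 'rV[R]_n => `|u0 - u|)); [exact: dist_cont|exact: cst_continuous].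
  apply: (@continuousB _ _ _ (fun=> kappa / 2)); first exact: cst_continuous.
  apply: (@continuousB _ _ _ (fun=> dot a a)); first exact: cst_continuous.
  have c : {for u, continuous (fun u => dot a (nu u))}.
    by apply: continuous_dot; [exact: cst_continuous | exact: nu_cont].
  exact: (continuousM c c).
pose C := W `&` theta @^-1` [set y : R | 0 <= y].
have C_compact : compact C.
  by apply: (compact_preimage_closed W_compact); [exact: theta_cont|exact: closed_ge].
pose e u := expR (alpha * dot (X u) a).
have e_cont u : W u -> {for u, continuous e}.
  move=> /W_ball bu.
  apply: (@continuous_comp _ _ _ (fun u => alpha * dot (X u) a) expR).
    apply: (@continuousM _ _ (fun=> alpha)); first exact: cst_continuous.
    exact: dotX_cont.
  exact: continuous_expR.
have h_cont u : W u -> {for u, continuous (fun u => f u / 2)}.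
  move=> /W_ball bu; apply: (@continuousM _ _ (fun u : 'rV[R]_n => f u)); first exact: f_cont.
  exact: cst_continuous.
(* For this [eps] the perturbed function is larger on [C] than at [u1], so its minimum over [W] is
   attained where [theta < 0]. *)
have [||||eps eps0 epsP] := @compact_perturbation _ _ C C_compact
    (fun u => f u / 2 - r2 / 2) (fun u => e u - e u1).
- move=> u [Wu _]; apply: (@continuousB _ _ _ (fun u => f u / 2)).
    exact: h_cont.
  exact: cst_continuous.
- move=> u [Wu _]; apply: (@continuousB _ _ _ e); first exact: e_cont.
  exact: cst_continuous.
- by move=> u [/W_ball bu _]; have := X_min bu; lra.
- move=> u [Wu /= th] fu; have {}fu : f u = r2 by lra.
  have Ku : KW u by split => //=; rewrite fu.
  rewrite subr_lt0 ltr_expR ltr_pM2l// lt_neqAle u1max// andbT.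
  apply/negP => /eqP uM; move: th; rewrite leNgt => /negP; apply.
  rewrite !gt_max psi_max// fu.
  have -> : kappa / 2 - kappa < 0 by lra.
  have -> : r2 - 4 * r2 < 0 by rewrite subr_lt0 ltr_pMl// ltr1n.
  rewrite !andbT subr_lt0 ltNge; apply/negP => su.
  have := bdry_lt u (conj Ku su); have := u1max _ K0.
  by rewrite uM => h1 h2; have := le_lt_trans h1 h2; rewrite ltxx.
have [|us Ws usmin] := compact_min W_compact (f := fun u => f u / 2 - eps * e u) _
  (ex_intro _ u0 K0.1).
  move=> u Wu; apply: (@continuousB _ _ _ (fun u => f u / 2)); first exact: h_cont.
  apply: (@continuousM _ _ (fun=> eps)); first exact: cst_continuous.
  exact: e_cont.
have : theta us < 0.
  rewrite ltNge; apply/negP => th.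
  by have := epsP us (conj Ws th); have := usmin _ K1.1; rewrite f1; lra.
rewrite !gt_max => /andP[/andP[t1 t2] t3].
have loc : \forall p \near us, f us / 2 - eps * expR (alpha * dot (X us) a) <=
     f p / 2 - eps * expR (alpha * dot (X p) a).
  have s2 : 0 < s / 2 by rewrite divr_gt0.
  apply: filterS (nbhsx_ballx us _ s2) => p; rewrite -ball_normE/= => pb.
  apply: usmin; rewrite /W/= -(subrK us u0) -addrA (le_trans (ler_normD _ _))//.
  by lra.
have h1 := hopf (W_ball Ws) alpha_gt0 eps0 loc.
have h2 : B * (dot a a + f us) <= B * (dot a a + 4 * r2).
  by rewrite ler_wpM2l// lerD2l; lra.
have h3 : alpha * (kappa / 2) < alpha * psi us by rewrite ltr_pM2l//; lra.
have h4 : alpha * (kappa / 2) = B * (dot a a + 4 * r2) + 1.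
  by rewrite /alpha; field; rewrite gt_eqF.
have := le_trans h1 h2; rewrite -/(psi us); lra.
Qed.

End MinOpen.

(** * Self-shrinkers of the Q_k-flow *)

Lemma dot_ball_compact (R : realType) (m : nat) (rho : R) :
  compact [set y : 'rV[R]_m | dot y y <= rho].
Proof.
have cl : closed [set y : 'rV[R]_m | dot y y <= rho].
  apply: (@preimage_closed _ _ (fun y : 'rV[R]_m => dot y y) [set y | y <= rho]).
    by move=> y _; apply: continuous_dot; exact: id.
  exact: closed_le.
have box := @rV_compact R m (fun=> `[- Num.sqrt rho, Num.sqrt rho]%classic)
  (fun=> @segment_compact _ _ _).
apply: subclosed_compact cl box _ => y /= hy i.
rewrite /= in_itv/= -ler_norml -sqrtr_sqr ler_wsqrtr// (le_trans _ hy)//.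
rewrite /dot (bigD1 i)//= expr2 lerDl sumr_ge0// => l _.
by rewrite -expr2 sqr_ge0.
Qed.

(* With [aa], [xx], [an], [xn] the numbers |a|^2, |x|^2, <a,nu>, <x,nu>. *)
Lemma hopf_arith (R : realFieldType) (delta alpha E s M h aa xx an xn : R) :
  0 < delta -> 0 < alpha -> 0 < E -> 0 < s ->
  0 <= h * s - alpha ^+ 2 * E * delta * (aa - an ^+ 2)
    - (xn - alpha * E * an) * (s * xn / 2) ->
  an ^+ 2 <= aa -> xn ^+ 2 <= xx -> s <= M -> 2 * h <= xn ^+ 2 ->
  alpha * (aa - an ^+ 2) <= M / (4 * delta) * (aa + xx).
Proof.
move=> delta0 alpha0 E0 s0 h3 h1 h2 sM h4.
have h5 : h * s <= xn ^+ 2 / 2 * s by rewrite ler_wpM2r ?(ltW s0)//; lra.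
(* The bound [2 * h <= xn ^+ 2] absorbs the terms free of [E]; what remains is divisible by
   [alpha * E], so the final estimate does not depend on [E]. *)
have h6 : alpha * E * (alpha * delta * (aa - an ^+ 2)) <= alpha * E * (an * s * xn / 2).
  apply: (@le_trans _ _ (xn ^+ 2 / 2 * s - (xn - alpha * E * an) * (s * xn / 2))).
    have -> : alpha * E * (alpha * delta * (aa - an ^+ 2)) =
      alpha ^+ 2 * E * delta * (aa - an ^+ 2) by ring.
    by lra.
  by rewrite le_eqVlt; apply/orP; left; apply/eqP; field.
rewrite ler_pM2l ?mulr_gt0// in h6.
have h7 : an * xn * s <= (aa + xx) / 2 * s.
  by rewrite ler_wpM2r ?(ltW s0)//; have := sqr_ge0 (an - xn); lra.
have h8 : (aa + xx) / 2 * s <= (aa + xx) / 2 * M.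
  rewrite ler_wpM2l//; have := sqr_ge0 an; have := sqr_ge0 xn; lra.
have -> : M / (4 * delta) * (aa + xx) = (aa + xx) / 2 * M / 2 / delta.
  by field; rewrite gt_eqF.
rewrite ler_pdivlMr// mulrAC.
have e : an * s * xn = an * xn * s by ring.
by rewrite e in h6; lra.
Qed.

Section Hypersurface.
Variables (R : realType) (S : topologicalType) (n k : nat).
Variables (A : set (chart R S n)) (x nu : S -> 'rV[R]_n.+1) (delta M : R).
Hypothesis k_lt_n : (k < n)%N.
Hypothesis S_atlas : smooth_atlas A.
Hypothesis x_immersion : immersion A x.
Hypothesis nu_normal : unit_normal A x nu.
Hypothesis x_shrinker : self_shrinker A x nu k.
Hypothesis sigma_le : forall c p, A c -> chart_dom c p ->
  `|sigma k (shape x nu c p)| <= M.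
Hypothesis delta_gt0 : 0 < delta.
Hypothesis newton_ge : forall c p, A c -> chart_dom c p -> forall v : 'rV[R]_n,
  delta * dot (v *m jac c x p) (v *m jac c x p) <=
  dot (v *m newton k (shape x nu c p) *m jac c x p) (v *m jac c x p).
Hypothesis x_perp_ge : forall p, 2 * (n - k)%N%:R <= dot (x p) (nu p) ^+ 2.

Lemma coord_paramK c u : A c -> chart_codom c u ->
  chart_dom c (param c u) /\ coord c (param c u) = u.
Proof.
move=> Ac [p cp <-]; have [/(_ _ Ac)[_ _ K _ _] _ _] := S_atlas.
by rewrite K.
Qed.

Lemma jac_param m (g : S -> 'rV[R]_m) c u : A c -> chart_codom c u ->
  jac c g (param c u) = 'J (g \o param c) u.
Proof. by move=> Ac Uu; exact: congr1 (coord_paramK Ac Uu).2. Qed.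

Lemma smooth_map_continuous m (g : S -> 'rV[R]_m) : smooth_map A g -> continuous g.
Proof.
move=> g_smooth p; have [charts cover _] := S_atlas.
have [c Ac cp] := cover p; have [dom_open _ K coord_cont _] := charts c Ac.
apply: (@near_eq_continuous _ _ _ ((g \o param c) \o coord c)).
  have : nbhs p (chart_dom c) by exact: open_nbhs_nbhs.
  by apply: filterS => q /K /= ->.
apply: continuous_comp; first exact: coord_cont.
by apply: (smooth_on_continuous (g_smooth c Ac)); exists p.
Qed.

(** [mxtrace_hessian] with both traces evaluated and [sigma k.+1] eliminated by the shrinker
    equation. *)
Lemma mxtrace_hessian_shrinker c p (a : 'rV[R]_n.+1) (tau beta : R) :
  A c -> chart_dom c p -> 0 <= tau ->
  (forall v : 'rV[R]_n,
     0 <= dot (v *m jac c x p) (v *m jac c x p) - tau * dot (v *m jac c x p) a ^+ 2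
       - beta * dot (v *m jac c x p) (v *m jac c nu p)) ->
  let s := sigma k (shape x nu c p) in
  0 < s /\ 0 <= (n - k)%:R * s - tau * delta * (dot a a - dot a (nu p) ^+ 2)
    - beta * (s * dot (x p) (nu p) / 2).
Proof.
move=> Ac cp tau0 Hge s.
have [nu_smooth nu_unit nu_orth] := nu_normal; have [x_smooth x_free] := x_immersion.
have Up : chart_codom c (coord c p) by exists p.
have [/(_ _ Ac)[_ U_open K _ _] _ _] := S_atlas.
have J_free := x_free c p Ac cp; have Jnu := nu_orth c p Ac cp.
have [s_neq0 shr] := x_shrinker Ac cp.
have k2 : k.+1%:R != 0 :> R by rewrite pnatr_eq0.
have xnu : dot (x p) (nu p) != 0.
  rewrite -sqrf_eq0 gt_eqF// (lt_le_trans _ (x_perp_ge p))//.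
  by rewrite mulr_gt0// ltr0n subn_gt0.
(* Since <x, nu> is nonzero, the shrinker equation makes [sigma k.+1] nonzero, which excludes the
   default value of [eigenvalues]. *)
have split : char_poly (shape x nu c p) =
    \prod_(i < n) ('X - (eigenvalues (shape x nu c p) 0 i)%:P).
  apply: (@eigenvaluesP _ _ _ k); apply: contra_neq xnu => h.
  have := shr; rewrite h mul0r => /esym/eqP; rewrite mulf_eq0 => /orP[|/eqP//].
  by rewrite invr_eq0 mulf_eq0 (negbTE k2) pnatr_eq0.
have n0 : (0 < n)%N by apply: leq_ltn_trans k_lt_n.
have trP := mxtrace_newton split (ltnW k_lt_n) n0.
have trPL := mxtrace_newton_mul split k_lt_n.
have s2 : k.+1%:R * sigma k.+1 (shape x nu c p) = s * dot (x p) (nu p) / 2.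
  have : sigma k.+1 (shape x nu c p) = s * ((2 * k.+1%:R)^-1 * dot (x p) (nu p)).
    by rewrite -shr mulrC divfK.
  by move=> ->; field.
have N_tangent : (jac c nu p <= jac c x p)%MS.
  apply: (orth_normal_sub J_free (nu_unit p) Jnu) => v.
  have := is_derive_unit_orth (is_derive_jacobian (nu_smooth c Ac) v Up).
  by move=> /(_ (fun u => nu_unit _)); rewrite /= K.
have LJ : jac c nu p = shape x nu c p *m jac c x p by rewrite /shape mulmxKpV.
have X_nu (q : 'rV[R]_n) (v : 'rV[R]_n) : chart_codom c q ->
    dot (v *m 'J (x \o param c) q) ((nu \o param c) q) = 0.
  move=> Uq; have [dq cq] := coord_paramK Ac Uq.
  by have := nu_orth c (param c q) Ac dq v; rewrite (jac_param x Ac Uq).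
have Nsym := second_fundamental_form_sym U_open (x_smooth c Ac) (nu_smooth c Ac)
  X_nu Up.
have tr1 := mxtrace_hessian J_free (nu_unit p) Jnu LJ Nsym (ltW delta_gt0)
  _ (newton_ge Ac cp).
split; last first.
  have := tr1 a 1 tau beta tau0; rewrite trP trPL s2 mul1r; apply => v.
  by rewrite mul1r; exact: Hge.
(* With [tau] and [beta] zero, the inequality says that the trace of [P_k] is nonnegative; as
   [sigma k] is nonzero, it is positive. *)
have := tr1 0 1 0 0 (lexx 0); rewrite trP mul1r !mul0r !subr0 => h.
have : 0 <= (n - k)%:R * s.
  by apply: h => v; rewrite mul1r !mul0r !subr0 dot_ge0.
by rewrite pmulr_rge0 ?ltr0n ?subn_gt0// lt_def s_neq0.
Qed.

(** The first order condition makes the ambient gradient [D] normal, so the second derivative of [x]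
    enters only through its normal component, the second fundamental form. *)
Lemma perturbed_min c u (a : 'rV[R]_n.+1) (alpha eps : R) :
  A c -> chart_codom c u -> 0 <= eps ->
  (\forall q \near u,
     dot (x (param c u)) (x (param c u)) / 2
       - eps * expR (alpha * dot (x (param c u)) a) <=
     dot (x (param c q)) (x (param c q)) / 2
       - eps * expR (alpha * dot (x (param c q)) a)) ->
  let p := param c u in
  let s := sigma k (shape x nu c p) in
  let E := eps * expR (alpha * dot (x p) a) in
  let D := x p - (alpha * E) *: a in
  [/\ D = dot D (nu p) *: nu p, 0 < s &
    0 <= (n - k)%:R * s - alpha ^+ 2 * E * delta * (dot a a - dot a (nu p) ^+ 2)
      - dot D (nu p) * (s * dot (x p) (nu p) / 2)].
Proof.
move=> Ac Uu eps0 umin p s E D; have [cp coordp] := coord_paramK Ac Uu.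
have [nu_smooth nu_unit nu_orth] := nu_normal; have [x_smooth x_free] := x_immersion.
have [/(_ _ Ac)[_ U_open K _ _] _ _] := S_atlas.
have X_nu (q : 'rV[R]_n) (v : 'rV[R]_n) : chart_codom c q ->
    dot (v *m 'J (x \o param c) q) ((nu \o param c) q) = 0.
  move=> Uq; have [dq cq] := coord_paramK Ac Uq.
  by have := nu_orth c (param c q) Ac dq v; rewrite (jac_param x Ac Uq).
have ord := perturbed_min_orders U_open (x_smooth c Ac) Uu umin.
have JE : jac c x p = 'J (x \o param c) u := jac_param x Ac Uu.
have NE : jac c nu p = 'J (nu \o param c) u := jac_param nu Ac Uu.
have DE : D = dot D (nu p) *: nu p.
  apply: (normal_colinear (x_free c p Ac cp) (nu_unit p) (nu_orth c p Ac cp)) => v.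
  by rewrite JE; exact: (ord v).1.
have E0 : 0 <= E := mulr_ge0 eps0 (expR_ge0 _).
have tau0 : 0 <= alpha ^+ 2 * E := mulr_ge0 (sqr_ge0 alpha) E0.
have [|s0 h] := @mxtrace_hessian_shrinker c p a _ (dot D (nu p)) Ac cp tau0.
  move=> v; rewrite JE NE; apply: le_trans (ord v).2 _; rewrite lerD2l.
  have normal_part (Z : 'rV[R]_n.+1) t : dot Z (nu p) = - t ->
      dot D Z <= - (dot D (nu p) * t).
    by move=> e; rewrite {1}DE dotZl (dotC (nu p) Z) e mulrN.
  apply: normal_part.
  exact: (second_fundamental_form U_open (x_smooth c Ac) (nu_smooth c Ac) X_nu v v Uu).
by split.
Qed.

Lemma hopf_shrinker c u (a : 'rV[R]_n.+1) (alpha eps : R) :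
  A c -> chart_codom c u -> 0 < alpha -> 0 < eps ->
  (\forall q \near u,
     dot (x (param c u)) (x (param c u)) / 2
       - eps * expR (alpha * dot (x (param c u)) a) <=
     dot (x (param c q)) (x (param c q)) / 2
       - eps * expR (alpha * dot (x (param c q)) a)) ->
  alpha * (dot a a - dot a (nu (param c u)) ^+ 2) <=
    M / (4 * delta) * (dot a a + dot (x (param c u)) (x (param c u))).
Proof.
move=> Ac Uu alpha0 eps0 umin; set p := param c u.
have [_ s0] := perturbed_min Ac Uu (ltW eps0) umin; rewrite -/p.
have [cp coordp] := coord_paramK Ac Uu; rewrite -/p in cp.
have sM := le_trans (ler_norm _) (sigma_le Ac cp).
have [_ nu_unit _] := nu_normal.
have := CauchySchwarz_dot (x p) (nu p); have := CauchySchwarz_dot a (nu p).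
rewrite nu_unit !mulr1 dotDl dotNl dotZl => h1 h2 h3.
apply: (hopf_arith delta_gt0 alpha0 _ s0 h3 h1 h2 sM (x_perp_ge p)).
exact: mulr_gt0 eps0 (expR_gt0 _).
Qed.

(** [perturbed_min] without perturbation: [D] is [x p0] itself, and the trace inequality gives <x,
    nu>^2 <= 2(n-k), opposite to [x_perp_ge]. *)
Lemma min_radius p0 : (forall p, dot (x p0) (x p0) <= dot (x p) (x p)) ->
  dot (x p0) (x p0) = 2 * (n - k)%:R /\ x p0 = dot (x p0) (nu p0) *: nu p0.
Proof.
move=> p0min; have [charts cover _] := S_atlas.
have [c Ac cp] := cover p0; have [_ _ K _ _] := charts c Ac.
have [_ nu_unit _] := nu_normal.
have [||] := @perturbed_min c (coord c p0) 0 0 0 Ac _ (lexx _).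
- by exists p0.
- by apply: filterE => q; rewrite K// !mul0r !subr0 ler_pM2r ?invr_gt0.
rewrite K// !(mul0r, mulr0, scaler0, subr0).
move=> xE s0 h; split=> //; apply/eqP; rewrite eq_le.
rewrite (dot_colinear xE) x_perp_ge andbT.
move: h; set s := sigma _ _ in s0 *; set b := dot _ _.
have -> : (n - k)%:R * s - b * (s * b / 2) = s * ((n - k)%:R - b ^+ 2 / 2) by field.
by rewrite (pmulr_rge0 _ s0) => h; lra.
Qed.

Lemma min_set_open p0 : (forall p, dot (x p0) (x p0) <= dot (x p) (x p)) ->
  \forall p \near p0, dot (x p) (x p) = dot (x p0) (x p0).
Proof.
move=> p0min; have [charts cover _] := S_atlas.
have [c Ac cp] := cover p0; have [dom_open U_open K coord_cont _] := charts c Ac.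
have [nu_smooth nu_unit nu_orth] := nu_normal; have [x_smooth x_free] := x_immersion.
have M0 : 0 <= M := le_trans (normr_ge0 _) (sigma_le Ac cp).
set u0 := coord c p0.
have Up : chart_codom c u0 by exists p0.
have xu0 : x (param c u0) = x p0 by rewrite K.
have [r r0 [rU rdef]] := jacobian_locally_definite U_open (x_smooth c Ac) Up
  (x_free c p0 Ac cp).
have sec := orthogonal_secant (x_smooth c Ac) rU rdef.
have r2 : dot (x p0) (x p0) = 2 * (n - k)%:R := (min_radius p0min).1.
have B0 : 0 <= M / (4 * delta) :=
  divr_ge0 M0 (mulr_ge0 (ler0n _ _) (ltW delta_gt0)).
have loc : \forall u \near u0, dot ((x \o param c) u) ((x \o param c) u) =
    dot ((x \o param c) u0) ((x \o param c) u0).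
  apply: (@min_locally_constant _ _ _ u0 r (M / (4 * delta)) (x \o param c)
    (nu \o param c)).
  - exact: r0.
  - exact: B0.
  - by rewrite /= xu0 r2 mulr_gt0// ltr0n subn_gt0.
  - by move=> u /rU; exact: smooth_on_continuous (x_smooth c Ac) _.
  - by move=> u /rU; exact: smooth_on_continuous (nu_smooth c Ac) _.
  - by move=> u _; rewrite /= xu0.
  - move=> u /rU Uu /= e; apply: (min_radius _).2 => p.
    by rewrite e xu0.
  (* At a minimum point [x] is normal, so a secant along its ray is orthogonal to the tangent vector
     with coordinates [w - u]. *)
  - move=> u w t bu bw e Xw; apply: (sec _ _ bu bw).
    have [du cu] := coord_paramK Ac (rU _ bu).
    have umin p : dot (x (param c u)) (x (param c u)) <= dot (x p) (x p).
      by have /= := e; rewrite xu0 => ->.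
    have xE := (min_radius umin).2.
    have -> : (x \o param c) w - (x \o param c) u =
        ((t - 1) * dot (x (param c u)) (nu (param c u))) *: nu (param c u).
      by rewrite Xw -{2}[(x \o param c) u]scale1r -scalerBl -scalerA -xE.
    rewrite dotZl (dotC (nu (param c u))).
    have := nu_orth c (param c u) Ac du (w - u).
    rewrite (jac_param x Ac (rU _ bu)) => ->.
    by rewrite mulr0.
  - by move=> u a alpha eps /rU Uu; exact: hopf_shrinker Ac Uu.
have dom_near : nbhs p0 (chart_dom c) by exact: open_nbhs_nbhs.
have near := @filterI _ _ (nbhs_filter p0) _ _ dom_near (coord_cont p0 cp _ loc).
apply: (@filterS _ _ (nbhs_filter p0) _ _ _ near) => p [dp /=].
by rewrite !K.
Qed.

Hypothesis S_connected : connected [set: S].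
Hypothesis x_proper : proper_map x.

Lemma norm_constant : [set: S] !=set0 ->
  forall p, dot (x p) (x p) = 2 * (n - k)%:R.
Proof.
move=> [p1 _]; have x_cont := smooth_map_continuous x_immersion.1.
have xx_cont : continuous (fun p => dot (x p) (x p)).
  by move=> p; exact: continuous_dot (x_cont p) (x_cont p).
(* A sublevel set of |x|^2, compact by properness, on which the global minimum is attained. *)
pose D := x @^-1` [set y | dot y y <= dot (x p1) (x p1)].
have D_compact : compact D by exact: x_proper (@dot_ball_compact _ _ _).
have D1 : D p1 by rewrite /D /= lexx.
have [|p0 D0 p0minD] := compact_min D_compact (f := fun p => dot (x p) (x p)) _
  (ex_intro _ p1 D1).
  by move=> p _; exact: xx_cont.
have p0min p : dot (x p0) (x p0) <= dot (x p) (x p).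
  have [Dp|nDp] := leP (dot (x p) (x p)) (dot (x p1) (x p1)); first exact: p0minD.
  by rewrite (le_trans _ (ltW nDp))//; exact: D0.
pose K := [set p | dot (x p) (x p) <= dot (x p0) (x p0)].
have KE p : K p -> dot (x p) (x p) = dot (x p0) (x p0).
  by move=> Kp; apply/eqP; rewrite eq_le; apply/andP; split; [exact: Kp|exact: p0min].
have K_open : open K.
  rewrite openE => p /KE Kp.
  have pmin q : dot (x p) (x p) <= dot (x q) (x q) by rewrite Kp; exact: p0min.
  apply: filterS (min_set_open pmin) => q e.
  by rewrite /K /= e Kp lexx.
have K_closed : closed K.
  apply: (@preimage_closed _ _ (fun p => dot (x p) (x p))
    [set y | y <= dot (x p0) (x p0)]); last exact: closed_le.
  by move=> p _; exact: xx_cont.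
have KT : K = [set: S].
  apply: S_connected.
  - by exists p0; rewrite /K /= lexx.
  - by exists K; rewrite ?setTI.
  - by exists K; rewrite ?setTI.
move=> p; rewrite -(min_radius p0min).1; apply: KE.
by rewrite KT.
Qed.

Lemma sphere_in_range (a : 'rV[R]_n.+1) : [set: S] !=set0 ->
  dot a a = 2 * (n - k)%:R -> exists p, x p = a.
Proof.
move=> S0 aa; have xx := norm_constant S0.
have x_cont := smooth_map_continuous x_immersion.1.
have S_compact : compact [set: S].
  have -> : [set: S] = x @^-1` [set y | dot y y <= 2 * (n - k)%:R].
    by apply/seteqP; split => p //= _; rewrite xx lexx.
  exact: x_proper (@dot_ball_compact _ _ _).
have [|p _ pmax] := compact_max S_compact (f := fun p => dot (x p) a) _ S0.
  by move=> q _; apply: continuous_dot; [exact: x_cont|exact: cst_continuous].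
have [charts cover _] := S_atlas.
have [c Ac cp] := cover p; have [dom_open U_open K _ _] := charts c Ac.
have [_ nu_unit nu_orth] := nu_normal; have [x_smooth x_free] := x_immersion.
have pmin q : dot (x p) (x p) <= dot (x q) (x q) by rewrite !xx lexx.
have [r2 xE] := min_radius pmin.
have Up : chart_codom c (coord c p) by exists p.
have aE : a = dot a (nu p) *: nu p.
  apply: (normal_colinear (x_free c p Ac cp) (nu_unit p) (nu_orth c p Ac cp)) => v.
  (* As |x| is constant, maximizing <x, a> minimizes the perturbed function, whose gradient is then
     normal; [x p] being normal too, so is [a]. *)
  have [||DE _ _] := @perturbed_min c (coord c p) a 1 1 Ac Up.
  - exact: ler01.
  - apply: filterE => q; rewrite K// !xx lerD2l lerN2 !mul1r ler_expR.
    exact: pmax.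
  move: DE; rewrite K// !mul1r; set E := expR _; set D := x p - _ => DE.
  have E0 : E != 0 by rewrite gt_eqF// expR_gt0.
  have Da : a = E^-1 *: (x p - D) by rewrite /D subKr scalerA mulVf// scale1r.
  rewrite Da dotZl dotDl dotNl DE xE !dotZl !(dotC (nu p) (v *m _)).
  by rewrite (nu_orth c p Ac cp v) !mulr0 subr0 mulr0.
have : dot a (nu p) ^+ 2 == dot (x p) (nu p) ^+ 2.
  by rewrite -(dot_colinear aE) -(dot_colinear xE) aa r2.
rewrite eqf_sqr => /orP[/eqP e|/eqP e]; first by exists p; rewrite xE -e -aE.
have xp : x p = - a by rewrite aE e scaleNr opprK.
(* The maximum of <x, a> is now -|a|^2, the least value possible on the sphere, so <x, a> is
   constant and [x] equals [- a] everywhere. *)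
have xcst q : x q = - a.
  apply/eqP; rewrite -subr_eq0 opprK -dot_eq0 eq_le dot_ge0 andbT.
  have := pmax q Logic.I; rewrite xp dotNl !(dotDl, dotDr) (dotC a (x q)) xx -aa.
  by lra.
have free := x_free c p Ac cp.
have n0 : (0 < n)%N by apply: leq_ltn_trans k_lt_n.
(* A nonzero tangent direction, available because [n > 0]; a constant [x] would annihilate it. *)
pose e0 : 'rV[R]_n := delta_mx 0 (Ordinal n0).
have e0J : e0 *m jac c x p = 0.
  apply: (etrans (esym (is_deriveE (is_derive_jacobian (x_smooth c Ac) e0 Up)))).
  have -> : x \o param c = cst (- a) by apply/funext => q; exact: xcst.
  exact: derive_cst.
have := mulmx_free_eq0 e0 free.
rewrite e0J eqxx => /esym/eqP/rowP/(_ (Ordinal n0)).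
by rewrite !mxE !eqxx => /eqP; rewrite oner_eq0.
Qed.

End Hypersurface.

Theorem theorem1p4 (R : realType) (S : topologicalType) (n k : nat)
  (A : set (chart R S n)) (x nu : S -> 'rV[R]_n.+1)
  (k_lt_n : (k < n)%N)
  (S_manifold : smooth_manifold A)
  (S_nonempty : [set: S] !=set0)
  (S_connected : connected [set: S])
  (S_orientable : orientable A)
  (x_immersion : immersion A x)
  (x_proper : proper_map x)
  (nu_normal : unit_normal A x nu)
  (x_shrinker : self_shrinker A x nu k)
  (sigma_bdd : sigma_bounded A x nu k)
  (newton_coercive :
     coercive A x (fun c p => newton k (shape x nu c p)))
  (x_perp_ge : forall p,
     2 * (n - k)%N%:R <= enorm (normal_part x nu p) ^+ 2) :
  range x = origin_sphere (Num.sqrt (2 * (n - k)%N%:R)).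
Proof.
have [_ _ S_atlas] := S_manifold; have [M sigma_le] := sigma_bdd.
have [delta delta_gt0 newton_ge] := newton_coercive.
have [_ nu_unit _] := nu_normal.
have perp_ge p : 2 * (n - k)%:R <= dot (x p) (nu p) ^+ 2.
  have := x_perp_ge p; rewrite enorm_sqr /normal_part dotZl dotZr nu_unit.
  by rewrite mulr1 expr2.
have c0 : 0 <= 2 * (n - k)%:R :> R by rewrite mulr_ge0.
apply/seteqP; split => [_ [p _ <-]|a /= a_norm].
  rewrite /origin_sphere /= /enorm.
  by rewrite (norm_constant k_lt_n S_atlas x_immersion nu_normal x_shrinker sigma_le
    delta_gt0 newton_ge perp_ge S_connected x_proper S_nonempty p).
have aa : dot a a = 2 * (n - k)%:R by rewrite -enorm_sqr a_norm sqr_sqrtr.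
have [p xp] := sphere_in_range k_lt_n S_atlas x_immersion nu_normal x_shrinker
  sigma_le delta_gt0 newton_ge perp_ge S_connected x_proper S_nonempty aa.
by exists p.
Qed.
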